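(* (a) For every permutation $w\in S_n$, the Newton polytope in $\mathbb{R}^n$ of the Schubert polynomial $X(w)\in\mathbb{Z}[x_1,\dots,x_n]$ is an MV polytope. (b) For every composition $\alpha=(\alpha_1,\dots,\alpha_n)\in\mathbb{Z}_{\ge0}^n$, the Newton polytope in $\mathbb{R}^n$ of the key polynomial $\kappa_\alpha\in\mathbb{Z}[x_1,\dots,x_n]$ is an MV polytope.
   Context: For a polynomial $f=\sum_{\alpha\in\mathbb{N}^n}c_\alpha x^\alpha$, $\operatorname{Newton}(f)=\operatorname{conv}(\alpha:c_\alpha\neq0)\subseteq\mathbb{R}^n$. The divided difference operator on polynomials in $x_1,\dots,x_n$ is $\partial_if=\frac{f-s_if}{x_i-x_{i+1}}$, where $s_i$ swaps the variables $x_i$ and $x_{i+1}$. For a permutation $u$ with reduced word $u=s_{i_1}\cdots s_{i_\ell}$ put $\partial_u=\partial_{i_1}\cdots\partial_{i_\ell}$ (independent of the choice of reduced word). With $w_0$ the longest permutation in $S_n$ and $u=w^{-1}w_0$, the Schubert polynomial is $X(w)=\partial_u(x_1^{n-1}x_2^{n-2}\cdots x_{n-1})$. The key polynomial $\kappa_\alpha$ is defined recursively: if $\alpha$ is weakly decreasing then $\kappa_\alpha=x_1^{\alpha_1}\cdots x_n^{\alpha_n}$; otherwise choose $i$ with $\alpha_i<\alpha_{i+1}$, let $\alpha'$ be obtained from $\alpha$ by switching $\alpha_i$ and $\alpha_{i+1}$, and set $\kappa_\alpha=\partial_i(x_i\kappa_{\alpha'})$. A generalized permutahedron on $[n]$ is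 a polytope $P\subseteq\mathbb{R}^n$ such that every edge of $P$ is parallel to a vector $e_i-e_j$ with $i\neq j$ (points are allowed), where $e_1,\dots,e_n$ is the standard basis. It is a lattice generalized permutahedron if all its vertices lie in $\mathbb{Z}^n$. Its supermodular function is $\mu^P(S)=\min_{x\in P}\sum_{i\in S}x_i$ for $S\subseteq[n]$. A lattice generalized permutahedron $P$ is a Mirković–Vilonen (MV) polytope on $[n]$ if for all $S\subseteq[n]$ and all $a<b<c$ in $[n]\setminus S$, $$\mu^P(S\cup\{b\})+\mu^P(S\cup\{a,c\})=\min\bigl(\mu^P(S\cup\{a\})+\mu^P(S\cup\{b,c\}),\ \mu^P(S\cup\{a,b\})+\mu^P(S\cup\{c\})\bigr).$$ *)

(* Defs.v *)
From HB Require Import structures.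
From mathcomp Require Import all_boot all_order all_algebra all_fingroup.
From mathcomp Require Import mpoly boolp classical_sets reals.

Set Implicit Arguments.
Unset Strict Implicit.
Unset Printing Implicit Defensive.

Import Order.TTheory GRing.Theory Num.Theory.

Local Open Scope ring_scope.
Local Open Scope classical_set_scope.

(* The adjacent pairs of indices are numbered by [i : 'I_n.-1]; the pair      *)
(* numbered [i] is [(lo i, hi i)], with underlying values [(i, i.+1)].        *)
Section Adjacent.
Variable n : nat.
Implicit Types (i : 'I_n.-1) (u v : {perm 'I_n}) (t : seq 'I_n.-1).

Definition lo i : 'I_n := widen_ord (leq_pred n) i.

Lemma hi_subproof i : (i.+1 < n)%N.
Proof. by rewrite -ltn_predRL. Qed.

Definition hi i : 'I_n := Ordinal (hi_subproof i).

Lemma lo_neq_hi i : lo i != hi i.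
Proof. by rewrite -val_eqE /= neq_ltn ltnSn. Qed.

Definition adj i : {perm 'I_n} := tperm (lo i) (hi i).

(* [(u * v)%g] maps [k] to [v (u k)], whereas products of permutations are    *)
(* composed here from right to left.                                          *)
Definition pcomp u v : {perm 'I_n} := (v * u)%g.

Definition word_perm t : {perm 'I_n} :=
  foldr (fun i u => pcomp (adj i) u) 1%g t.

Definition reduced_word t u : Prop :=
  word_perm t = u /\ forall t', word_perm t' = u -> (size t <= size t')%N.

Lemma word_perm_cat t1 t2 :
  word_perm (t1 ++ t2) = pcomp (word_perm t1) (word_perm t2).
Proof.
by elim: t1 => [|i t1 IH] /=; rewrite /pcomp ?mulg1 // IH /pcomp mulgA.
Qed.

Lemma tperm_word (d : nat) (a b : 'I_n) :
  (b = a + d :> nat)%N -> exists t, word_perm t = tperm a b.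
Proof.
elim: d b => [|d IH] b e.
  by exists [::]; rewrite (_ : b = a) ?tperm1 //; apply: val_inj; rewrite /= e addn0.
have hd : (a + d < n.-1)%N by rewrite ltn_predRL -addnS -e.
pose i := Ordinal hd.
have [t et] := IH (lo i) erefl.
have eb : hi i = b by apply: val_inj; rewrite /= e addnS.
case: (posnP d) => [d0|dpos].
  exists [:: i]; rewrite /= /pcomp mul1g /adj eb; congr tperm.
  by apply: val_inj; rewrite /= d0 addn0.
exists (i :: t ++ [:: i]); rewrite /= word_perm_cat et /= /pcomp mul1g.
have na : a != lo i by rewrite -val_eqE /= neq_ltn -{1}[val a]addn0 ltn_add2l dpos.
have nb : a != hi i.
  by rewrite eb -val_eqE /= e neq_ltn -{1}[val a]addn0 ltn_add2l.
have -> : tperm a b = (tperm a (lo i) ^ adj i)%g.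
  by rewrite tpermJ /adj tpermL (tpermD (z := a)) 1?eq_sym // eb.
by rewrite conjgE /adj tpermV mulgA.
Qed.

Lemma exists_word u : exists t, word_perm t = u.
Proof.
have [ts ->] := prod_tpermP u; move=> _ {u}.
elim: ts => [|[a b] ts [t IH]]; first by exists [::]; rewrite big_nil.
have [t' et'] : exists t', word_perm t' = tperm a b.
  case: (leqP a b) => [ab|/ltnW ba].
    by apply: (@tperm_word (b - a)); rewrite subnKC.
  by rewrite tpermC; apply: (@tperm_word (a - b)); rewrite subnKC.
by exists (t ++ t'); rewrite word_perm_cat IH et' big_cons.
Qed.

Lemma exists_reduced_word u : exists t, reduced_word t u.
Proof.
pose P k := `[< exists2 t, word_perm t = u & size t = k >].
have exP : exists k, P k.
  by have [t et] := exists_word u; exists (size t); apply/asboolP; exists t.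
case: (ex_minnP exP) => k /asboolP[t et <-] kmin.
by exists t; split=> // t' et'; apply: kmin; apply/asboolP; exists t'.
Qed.

Definition longest_perm : {perm 'I_n} := perm (@rev_ord_inj n).

End Adjacent.

Section SchubertKey.
Variable n : nat.
Implicit Types (i : 'I_n.-1) (f g : {mpoly int[n]}) (al : 'X_{1..n}).

Lemma divdiff_subproof i f :
  exists g, g * ('X_(lo i) - 'X_(hi i)) == f - msym (adj i) f.
Proof.
set d := _ - _.
pose D f := exists g, g * d = f - msym (adj i) f.
suff: D f by case=> g /eqP e; exists g.
have D0 : D 0 by exists 0; rewrite msym0 mul0r subr0.
have D1 : D 1 by exists 0; rewrite msym1 mul0r subrr.
have DD p q : D p -> D q -> D (p + q).
  by move=> [g e] [h e']; exists (g + h); rewrite mulrDl e e' msymD opprD addrACA.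
have DZ c p : D p -> D (c *: p).
  by move=> [g e]; exists (c *: g); rewrite -scalerAl e scalerBr msymZ.
have DM p q : D p -> D q -> D (p * q).
  move=> [g e] [h e']; exists (g * q + msym (adj i) p * h).
  rewrite mulrDl mulrAC e -mulrA e' msymM mulrBl mulrBr.
  by rewrite addrA addrNK.
have DX k : D 'X_k.
  rewrite /D /msym mmapX mmap1U /adj; case: tpermP => [->|->|_ _].
  - by exists 1; rewrite mul1r.
  - by exists (-1); rewrite mulN1r opprB.
  - by exists 0; rewrite mul0r subrr.
elim/mpolyind: f => // c m p _ _ Dp; apply: DD => //; apply: DZ.
rewrite mpolyXE_id; apply: big_ind => // k _.
by elim: (m k) => [|e IH]; rewrite ?expr0 // exprS; apply: DM.
Qed.

Definition divdiff i f : {mpoly int[n]} := xchoose (divdiff_subproof i f).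

Lemma divdiffE i f :
  divdiff i f * ('X_(lo i) - 'X_(hi i)) = f - msym (adj i) f.
Proof. exact/eqP/(xchooseP (divdiff_subproof i f)). Qed.

Lemma divdiff_unique i f g :
  g * ('X_(lo i) - 'X_(hi i)) = f - msym (adj i) f -> g = divdiff i f.
Proof.
rewrite -divdiffE; apply: mulIf; rewrite subr_eq0.
apply/eqP => /(congr1 (mcoeff U_(lo i)%MM)) /eqP.
by rewrite !mcoeffXU eqxx [hi i == _]eq_sym (negbTE (lo_neq_hi i)) oner_eq0.
Qed.

Definition word_divdiff (t : seq 'I_n.-1) f : {mpoly int[n]} :=
  foldr divdiff f t.

Definition staircase : 'X_{1..n} := [multinom (n - k.+1)%N | k < n].

(* [is_schubert w f]: [f] is the Schubert polynomial of [w], computed along   *)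
(* some reduced word of [w^-1 w_0].                                           *)
Definition is_schubert (w : {perm 'I_n}) f : Prop :=
  exists2 t, reduced_word t (pcomp w^-1%g (longest_perm n))
           & f = word_divdiff t 'X_[staircase].

Lemma exists_schubert w : exists f, is_schubert w f.
Proof.
have [t rt] := exists_reduced_word (pcomp w^-1%g (longest_perm n)).
by exists (word_divdiff t 'X_[staircase]), t.
Qed.

Definition weakly_decreasing al : Prop :=
  forall j k : 'I_n, (j <= k)%N -> (al k <= al j)%N.

Definition switch i al : 'X_{1..n} := [multinom al (adj i k) | k < n].

(* [is_key al f]: [f] is the key polynomial of [al], computed along some      *)
(* sequence of choices of ascents.                                            *)
Inductive is_key : 'X_{1..n} -> {mpoly int[n]} -> Prop :=
| is_key_decreasing al : weakly_decreasing al -> is_key al 'X_[al]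
| is_key_ascent al i f :
    (al (lo i) < al (hi i))%N -> is_key (switch i al) f ->
    is_key al (divdiff i ('X_(lo i) * f)).

Lemma exists_key al : exists f, is_key al f.
Proof.
pose wt (be : 'X_{1..n}) := (\sum_(k < n) k * be k)%N.
have [N] := ubnP (wt al); elim: N al => // N IH al; rewrite ltnS => leN.
case: (pickP (fun i => (al (lo i) < al (hi i))%N)) => [i lti|nasc].
  have [|f kf] := IH (switch i al); last first.
    by exists (divdiff i ('X_(lo i) * f)); apply: is_key_ascent.
  apply: leq_trans leN; rewrite /wt.
  have D2 (F : 'I_n -> nat) : (\sum_k F k =
      F (lo i) + (F (hi i) + \sum_(k | (k != lo i) && (k != hi i)) F k))%N.
    by rewrite (bigD1 (lo i)) //= (bigD1 (hi i)) //= eq_sym lo_neq_hi.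
  rewrite !D2 !mnmE /adj tpermL tpermR.
  rewrite [X in (_ + (_ + X) < _)%N](eq_bigr (fun k : 'I_n => k * al k)%N).
    have ar (q x y : nat) : (x < y -> q * y + q.+1 * x < q * x + q.+1 * y)%N.
      move=> xy; rewrite !mulSn addnCA [X in (_ < X)%N]addnCA.
      by rewrite [(q * x + _)%N]addnC ltn_add2r.
    set s := bigop _ _ _; have h := ar (lo i) _ _ lti.
    by rewrite !(addnA _ _ s) (ltn_add2r s).
  by move=> k /andP[kl kh]; rewrite mnmE tpermD // eq_sym.
exists 'X_[al]; apply: is_key_decreasing.
suff dec d (j k : 'I_n) : (k = j + d :> nat)%N -> (al k <= al j)%N.
  by move=> j k jk; apply: (dec (k - j)%N); rewrite subnKC.
elim: d k => [|d IHd] k e.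
  by rewrite (_ : k = j) //; apply: val_inj; rewrite /= e addn0.
have hd : (j + d < n.-1)%N by rewrite ltn_predRL -addnS -e.
have := nasc (Ordinal hd) => /negbT; rewrite -leqNgt => le1.
rewrite (_ : k = hi (Ordinal hd)); last by apply: val_inj; rewrite /= e addnS.
exact: leq_trans le1 (IHd _ _).
Qed.

End SchubertKey.

Section Polytopes.
Variables (R : realType) (n : nat).
Implicit Types (A P F : set 'rV[R]_n) (S : {set 'I_n}).

Definition conv A : set 'rV[R]_n :=
  [set x | exists k (v : 'I_k -> 'rV[R]_n) (c : 'I_k -> R),
     [/\ forall j, A (v j), forall j, 0 <= c j, \sum_j c j = 1
       & x = \sum_j c j *: v j]].

Definition newton (f : {mpoly int[n]}) : set 'rV[R]_n :=
  conv [set \row_j (m j)%:R | m in [set m | m \in msupp f]].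

Definition is_polytope P : Prop :=
  exists2 s : seq 'rV[R]_n, s <> [::] & P = conv [set x | x \in s].

(* Faces are cut out by valid inequalities [d <= c . x].                      *)
Definition is_face P F : Prop :=
  exists (c : 'I_n -> R) (d : R),
    (forall x, P x -> d <= \sum_j c j * x 0 j) /\
    F = [set x | P x /\ \sum_j c j * x 0 j = d].

Definition is_vertex P (v : 'rV[R]_n) : Prop := is_face P [set v].

(* An edge is a face whose affine hull is a line.                             *)
Definition is_edge P F : Prop :=
  is_face P F /\
  exists x y, [/\ F x, F y, x != y
                & forall z, F z -> exists t : R, z = x + t *: (y - x)].

Definition parallel_to F (u : 'rV[R]_n) : Prop :=
  forall x y, F x -> F y -> exists t : R, y - x = t *: u.

Definition generalized_permutahedron P : Prop :=
  is_polytope P /\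
  forall F, is_edge P F ->
    exists i j : 'I_n, i != j /\ parallel_to F ('e_i - 'e_j).

Definition lattice_generalized_permutahedron P : Prop :=
  generalized_permutahedron P /\
  forall v, is_vertex P v -> forall j, exists z : int, v 0 j = z%:~R.

(* The least element of [A], with junk value [0] if there is none; the sets   *)
(* it is applied to below have one when [P] is a polytope.                    *)
Definition set_min (A : set R) : R := xget 0 [set m | A m /\ lbound A m].

Definition supermod P S : R := set_min [set \sum_(i in S) x 0 i | x in P].

Definition MV_polytope P : Prop :=
  lattice_generalized_permutahedron P /\
  forall S (a b c : 'I_n), a \notin S -> b \notin S -> c \notin S ->
    (a < b)%N -> (b < c)%N ->
    supermod P (S :|: [set b]) + supermod P (S :|: [set a; c]) =
    Num.min (supermod P (S :|: [set a]) + supermod P (S :|: [set b; c]))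
            (supermod P (S :|: [set a; b]) + supermod P (S :|: [set c])).

End Polytopes.

Arguments newton R {n} f.

(* Main.v *)
(* The exponents of a polynomial f are recorded by a set function mu together *)
(* with the property that every chain of sets is simultaneously tight at one  *)
(* exponent ([tight]). By the greedy algorithm this makes Newton(f) a lattice *)
(* generalized permutahedron with supermodular function mu. If mu does not    *)
(* increase when lo i is replaced by hi i in its argument, then applying the  *)
(* isobaric operator f |-> d_i(x_i f) only symmetrizes mu ([reflect_mu]), and *)
(* this symmetrization preserves the tropical MV relations.                   *)
(* The monotonicity comes from mu being a sum of set functions of Schubert    *)
(* matroids, one per column of a diagram. For the key polynomials the columns *)
(* are {k : j < al k}. For X(w) they are the columns of the Rothe diagram,    *)
(* and one takes i the first ascent of w: then X(w s_i) = x_1 ... x_i Y, so   *)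
(* X(w) = d_i X(w s_i) = x_1 ... x_(i-1) d_i(x_i Y). That any reduced word    *)
(* may be replaced by one starting with i is Matsumoto's theorem, which       *)
(* follows from the braid relations of the divided differences.               *)

Require Import Defs.
From mathcomp Require Import all_boot all_order all_algebra all_fingroup.
From mathcomp Require Import mpoly boolp classical_sets reals.
From mathcomp Require Import fintype finset zify ring lra.

Set Implicit Arguments.
Unset Strict Implicit.
Unset Printing Implicit Defensive.

Import Order.TTheory GRing.Theory Num.Theory.

(** * Reflections of set functions *)

(** The operator [f |-> d_i(x_i f)] acts separately on each line of exponents along which only the
    coordinates [lo i] and [hi i] vary, with constant sum. Writing x, y for the two variables, it
    sends x^p y^q with p >= q to the full string from x^p y^q to x^q y^p, and with p < q to minus
    the open string between these ends. Hence coefficients at the x-heavy end of a line survive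
    ([mcoeff_divdiff_extreme]). When [mu] is [dominant], these ends and their mirror images
    determine the new set function, namely [reflect_mu] ([tight_reflect]), and the MV relations
    survive the reflection ([tropical_reflect]).

    Dominance persists because [mu] is a sum of functions [col_min D], which are always dominant,
    and because reflecting such a function just swaps [D], provided [hi i \in D] implies
    [lo i \in D] ([col_min_swap]). Key polynomials arise in this way from monomials
    ([tight_tropical_key]). For Schubert polynomials the plain divided difference at the first
    ascent becomes an isobaric one once a monomial is split off ([tight_tropical_schubert]); the
    freedom to choose that ascent is [schubert_rec_unique].

    To pass from tightness to polytopes, sort the coordinates by a linear functional: an exponent
    tight on the sorted chain minimizes the functional ([tight_min]). Chains sorted for the same
    functional differ by adjacent swaps of ties, and each swap moves the tight exponent along some
    e_a - e_b. A face of dimension one must therefore have such a direction, since otherwise it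
    would be a point ([edge_direction]). *)

Section SetFunctions.
Variable n : nat.
Implicit Types (i : 'I_n.-1) (S D : {set 'I_n}) (mu : {set 'I_n} -> nat).

Definition swap_set i S : {set 'I_n} := [set k | adj i k \in S].

Lemma adjK i : involutive (adj i).
Proof. exact: tpermK. Qed.

Lemma adj_lo i : adj i (lo i) = hi i. Proof. exact: tpermL. Qed.
Lemma adj_hi i : adj i (hi i) = lo i. Proof. exact: tpermR. Qed.

Lemma adj_other i k : k != lo i -> k != hi i -> adj i k = k.
Proof. by move=> h1 h2; rewrite /adj tpermD // eq_sym. Qed.

Lemma swap_setK i : involutive (swap_set i).
Proof. by move=> S; apply/setP=> k; rewrite !inE adjK. Qed.

Lemma swap_setU i S D : swap_set i (S :|: D) = swap_set i S :|: swap_set i D.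
Proof. by apply/setP=> k; rewrite !inE. Qed.

Lemma swap_set1 i a : swap_set i [set a] = [set adj i a].
Proof. by apply/setP=> k; rewrite !inE -(inj_eq (@perm_inj _ (adj i))) adjK. Qed.

Lemma swap_set2 i a b : swap_set i [set a; b] = [set adj i a; adj i b].
Proof. by rewrite swap_setU !swap_set1. Qed.

Lemma swap_set_id i S : (lo i \in S) = (hi i \in S) -> swap_set i S = S.
Proof.
move=> e; apply/setP=> k; rewrite inE /adj.
by case: tpermP => [->|->|//]; rewrite e.
Qed.

(** Under [dominant i mu] this is the minimum of [mu S] and [mu (swap_set i S)]. *)
Definition reflect_mu i mu S : nat :=
  if (lo i \in S) && (hi i \notin S) then mu (swap_set i S) else mu S.

Definition dominant i mu : Prop := forall S,
  lo i \in S -> hi i \notin S -> (mu (swap_set i S) <= mu S)%N.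

Definition tropical mu : Prop := forall S (a b c : 'I_n),
  a \notin S -> b \notin S -> c \notin S -> (a < b)%N -> (b < c)%N ->
  (mu (S :|: [set b]) + mu (S :|: [set a; c]) =
   minn (mu (S :|: [set a]) + mu (S :|: [set b; c]))
        (mu (S :|: [set a; b]) + mu (S :|: [set c])))%N.

Lemma reflect_mu_swap i mu S : reflect_mu i mu (swap_set i S) = reflect_mu i mu S.
Proof.
rewrite /reflect_mu !inE adj_lo adj_hi swap_setK.
by case hl: (lo i \in S); case hh: (hi i \in S) => //=;
  rewrite swap_set_id // hl hh.
Qed.

Lemma adj_lt i (a b : 'I_n) :
  (a < b)%N -> ~~ ((a == lo i) && (b == hi i)) -> (adj i a < adj i b)%N.
Proof.
rewrite /adj; case: tpermP => [->|->|/eqP + /eqP];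
  case: tpermP => [->|->|/eqP + /eqP]; rewrite -?val_eqE /=; lia.
Qed.

(** If [(a, b)] or [(b, c)] is [(lo i, hi i)], the left side coincides with one term of the minimum,
    and the remaining inequality follows from the old relation and dominance. Otherwise the relation
    is an old one, for the given sets or for their images under [adj i]. *)
Lemma tropical_reflect i mu :
  dominant i mu -> tropical mu -> tropical (reflect_mu i mu).
Proof.
move=> dom mv S a b c aS bS cS ab bc.
have good (T : {set 'I_n}) : (lo i \in T) ==> (hi i \in T) -> reflect_mu i mu T = mu T.
  by rewrite /reflect_mu; case: (_ \in T) => //= ->.
have lohi : lo i != hi i := lo_neq_hi i.
have [hab|hab] := boolP ((a == lo i) && (b == hi i)).
  have [/eqP ea /eqP eb] := andP hab.
  have cl : c != lo i by rewrite -ea -val_eqE /=; lia.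
  have ch : c != hi i by rewrite -eb -val_eqE /=; lia.
  have sS : swap_set i S = S by rewrite swap_set_id // -ea -eb (negbTE aS) (negbTE bS).
  have e1 : reflect_mu i mu (S :|: [set a]) = reflect_mu i mu (S :|: [set b]).
    by rewrite -reflect_mu_swap swap_setU sS swap_set1 ea adj_lo eb.
  have e2 : reflect_mu i mu (S :|: [set a; c]) = reflect_mu i mu (S :|: [set b; c]).
    by rewrite -reflect_mu_swap swap_setU sS swap_set2 ea adj_lo eb adj_other.
  rewrite e1 e2 !good ?inE -?ea -?eb ?eqxx ?orbT ?implybT //; last first.
    by rewrite (negbTE aS) eq_sym ea (negbTE cl).
  have h1 : lo i \in S :|: [set a; c] by rewrite -ea !inE eqxx orbT.
  have h2 : hi i \notin S :|: [set a; c].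
    by rewrite !inE -eb (negbTE bS) -!val_eqE /=; lia.
  have := dom _ h1 h2; rewrite swap_setU sS swap_set2 ea adj_lo (adj_other cl ch) -eb.
  have arith x y z t u v : (x + y = minn (z + t) (u + v) -> t <= y ->
    x + t = minn (x + t) (u + v))%N by clear; lia.
  by have := mv S a b c aS bS cS ab bc; rewrite ea; apply: arith.
have [hbc|hbc] := boolP ((b == lo i) && (c == hi i)).
  have [/eqP eb /eqP ec] := andP hbc.
  have al : a != lo i by rewrite -eb -val_eqE /=; lia.
  have ah : a != hi i by rewrite -ec -val_eqE /=; lia.
  have sS : swap_set i S = S by rewrite swap_set_id // -eb -ec (negbTE bS) (negbTE cS).
  have e1 : reflect_mu i mu (S :|: [set b]) = reflect_mu i mu (S :|: [set c]).
    by rewrite -reflect_mu_swap swap_setU sS swap_set1 eb adj_lo ec.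
  have e2 : reflect_mu i mu (S :|: [set a; b]) = reflect_mu i mu (S :|: [set a; c]).
    by rewrite -reflect_mu_swap swap_setU sS swap_set2 eb adj_lo ec adj_other.
  rewrite e1 e2 !good ?inE -?eb -?ec ?eqxx ?orbT ?implybT //; last first.
    by rewrite (negbTE bS) eq_sym eb (negbTE al).
  have h1 : lo i \in S :|: [set b] by rewrite -eb !inE eqxx orbT.
  have h2 : hi i \notin S :|: [set b].
    by rewrite !inE -ec (negbTE cS) -val_eqE /=; lia.
  have := dom _ h1 h2; rewrite swap_setU sS swap_set1 eb adj_lo -ec.
  have arith x y z t u v : (x + y = minn (z + t) (u + v) -> v <= x ->
    v + y = minn (z + t) (y + v))%N by clear; lia.
  by have := mv S a b c aS bS cS ab bc; rewrite eb; apply: arith.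
(* Here none of the six sets contains [lo i] without [hi i], so the reflection changes nothing. *)
have case1 (T : {set 'I_n}) (x y z : 'I_n) : x \notin T -> y \notin T ->
    z \notin T -> (x < y)%N -> (y < z)%N ->
    (hi i \in T) || [&& lo i \notin T, lo i != x, lo i != y & lo i != z] ->
    (reflect_mu i mu (T :|: [set y]) + reflect_mu i mu (T :|: [set x; z]) =
   minn (reflect_mu i mu (T :|: [set x]) + reflect_mu i mu (T :|: [set y; z]))
        (reflect_mu i mu (T :|: [set x; y]) + reflect_mu i mu (T :|: [set z])))%N.
  move=> xT yT zT xy yz h; have {}h (X : {set 'I_n}) : X \subset [set x; y; z] ->
      reflect_mu i mu (T :|: X) = mu (T :|: X).
    move=> /subsetP sX; apply: good; rewrite !inE; apply/implyP.
    case/orP: h => [->//|/and4P[/negbTE-> h1 h2 h3]] /= /sX.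
    by rewrite !inE (negbTE h1) (negbTE h2) (negbTE h3).
  rewrite !h; first [exact: mv | apply/subsetP=> k; rewrite !inE;
    by case: (k == x); case: (k == y); case: (k == z)].
have [h|h] := boolP ((hi i \in S) ||
  [&& lo i \notin S, lo i != a, lo i != b & lo i != c]).
  exact: case1.
move: h; rewrite negb_or !negb_and !negbK => /andP[hS h].
(* Now [hi i] is not in [S], while [lo i] is in [S] or among [a], [b], [c]. After the swap [case1]
   applies: [reflect_mu] is swap-invariant, and [adj i] keeps the order of [a], [b], [c]. *)
have := case1 (swap_set i S) (adj i a) (adj i b) (adj i c).
rewrite !inE !adjK -!swap_set1 -!swap_setU !reflect_mu_swap.
rewrite adj_lt // adj_lt // adj_hi adj_lo; apply => //.
apply/orP; case/orP: h => [->|h]; [by left|right].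
rewrite hS /=; move: h hab hbc ab bc; rewrite /adj.
by do 3![case: tpermP => [->|->|/eqP + /eqP]]; rewrite -?val_eqE /= ?eqxx; lia.
Qed.

Lemma tropical_addl (o : 'I_n -> nat) mu :
  tropical mu <-> tropical (fun S => \sum_(k in S) o k + mu S)%N.
Proof.
have sU S a : a \notin S -> (\sum_(k in S :|: [set a]) o k = \sum_(k in S) o k + o a)%N.
  by move=> aS; rewrite setUC big_setU1 // addnC.
have sUU S a b : a \notin S -> b \notin S -> (a < b)%N ->
    (\sum_(k in S :|: [set a; b]) o k = \sum_(k in S) o k + o a + o b)%N.
  move=> aS bS ab; rewrite setUA sU ?sU // !inE negb_or bS eq_sym.
  by rewrite -val_eqE /= (ltn_eqF ab).
split=> mv S a b c aS bS cS ab bc; have := mv S a b c aS bS cS ab bc;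
  by rewrite !sU // !sUU // ?(ltn_trans ab bc) //; lia.
Qed.

End SetFunctions.

(** * Schubert matroids *)

Section SchubertMatroid.
Variable n : nat.
Implicit Types (i : 'I_n.-1) (S D : {set 'I_n}) (k : nat).

Definition count_below D k : nat := \sum_(r < n) ((r < k) && (r \in D) : nat).

Lemma count_belowS D (r : 'I_n) :
  count_below D r.+1 = (count_below D r + (r \in D))%N.
Proof.
rewrite /count_below (bigD1 r) //= ltnSn addnC; congr (_ + _)%N.
rewrite [RHS](bigD1 r) //= ltnn add0n; apply: eq_bigr => j jr.
by rewrite ltnS leq_eqVlt (inj_eq val_inj) (negbTE jr).
Qed.

Lemma count_below_le D k : (count_below D k <= k)%N.
Proof.
elim: k => [|k IH]; first by rewrite /count_below big1.
case: (ltnP k n) => [kn|nk].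
  by rewrite (@count_belowS D (Ordinal kn)) -addn1 leq_add // leq_b1.
apply: leq_trans (leq_trans IH (leqnSn k)); apply: leq_sum => r _.
by rewrite (leq_trans (ltn_ord r) nk) (leq_trans (ltn_ord r)) // ltnW.
Qed.

Lemma count_below_swap i D k :
  k != i.+1 -> count_below (swap_set i D) k = count_below D k.
Proof.
move=> ki; rewrite /count_below (reindex_inj (@perm_inj _ (adj i))) /=.
apply: eq_bigr => r _; rewrite inE adjK; congr (_ && _ : nat).
by rewrite /adj; case: tpermP => [->|->|//] /=; move: ki; lia.
Qed.

(* The corank-type function [min_B |B :&: S|] of the Schubert matroid whose   *)
(* bases [B] are the sets below [D] in the componentwise order. The maximum   *)
(* comes from the rank formula for nested matroids; the truncation is         *)
(* harmless since the term of index [0] is [0].                               *)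
Definition col_min D S : nat :=
  \max_(k < n.+1) (count_below D k + count_below S k - k)%N.

Lemma col_min_ge D S k : (k <= n)%N ->
  (count_below D k + count_below S k - k <= col_min D S)%N.
Proof.
move=> kn; pose F (k : 'I_n.+1) := (count_below D k + count_below S k - k)%N.
by have := @leq_bigmax _ F (inord k); rewrite /F inordK.
Qed.

Lemma col_min_le D S D' S' :
  (forall k, (k <= n)%N -> exists2 k', (k' <= n)%N &
     (count_below D k + count_below S k - k <=
      count_below D' k' + count_below S' k' - k')%N) ->
  (col_min D S <= col_min D' S')%N.
Proof.
move=> h; apply/bigmax_leqP => k _; have [k' kn le] := h k (leq_ord k).
exact: leq_trans le (col_min_ge _ _ kn).
Qed.

(** Replacing [lo i] by [hi i] in [S] lowers [count_below S] at index [i.+1] only, so no term of the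
    maximum grows. *)
Lemma col_min_dominant i D : dominant i (col_min D).
Proof.
move=> S ls hs; apply: col_min_le => k kn; exists k => //.
apply: leq_sub2r; rewrite leq_add2l.
have [->|ki] := eqVneq k i.+1; last by rewrite count_below_swap.
rewrite -[i in i.+1]/(val (lo i)) !count_belowS count_below_swap ?leq_add2l //=.
  by rewrite inE adj_lo ls leq_b1.
by rewrite /= neq_ltn ltnSn.
Qed.

(* The terms of [col_min] on the two sides differ at index [i.+1] only, and   *)
(* there each is dominated by a neighbouring term of the other side.          *)
Lemma col_min_swap i D S : (hi i \in D) ==> (lo i \in D) ->
  col_min (swap_set i D) S = reflect_mu i (col_min D) S.
Proof.
move=> hD.
suff loc D1 D2 S1 S2 :
    (forall k, k != i.+1 -> (count_below D1 k + count_below S1 k =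
       count_below D2 k + count_below S2 k)%N) ->
    (let t D S k := count_below D k + count_below S k in
     let d D S := ((lo i \in D) + (lo i \in S), (hi i \in D) + (hi i \in S)) in
     let: (a, b) := d D1 S1 in let: (a', b') := d D2 S2 in
     [|| a <= a', a <= 1 | (1 <= b)])%N ->
    (col_min D1 S1 <= col_min D2 S2)%N.
  rewrite /reflect_mu; apply/eqP; rewrite eqn_leq.
  case: ifP => hS; apply/andP; split; apply: loc => [k ki|];
   rewrite ?count_below_swap //= ?inE ?adj_lo ?adj_hi; move: hD hS;
   by case: (lo i \in D); case: (hi i \in D); case: (lo i \in S); case: (hi i \in S).
move=> eqk; rewrite /= => hd; apply: col_min_le => k kn.
have [ek|ki] := eqVneq k i.+1; last by exists k; rewrite // eqk.
have in2 : (i.+2 <= n)%N by exact: hi_subproof.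
have e0 := eqk i; have e2 := eqk i.+2.
have := (count_belowS D1 (lo i), count_belowS D1 (hi i),
  count_belowS D2 (lo i), count_belowS D2 (hi i),
  count_belowS S1 (lo i), count_belowS S1 (hi i),
  count_belowS S2 (lo i), count_belowS S2 (hi i)) => /= f.
have {}e0 : (count_below D1 i + count_below S1 i = count_below D2 i + count_below S2 i)%N.
  by apply: e0; rewrite neq_ltn ltnSn.
have {}e2 : (count_below D1 i.+2 + count_below S1 i.+2 = count_below D2 i.+2 + count_below S2 i.+2)%N.
  by apply: e2; rewrite neq_ltn ltnSn orbT.
rewrite ek; move: f e0 e2 => [[[[[[[f1 f2] f3] f4] f5] f6] f7] f8] e0 e2.
(* Let a and b be the increments of the left-hand count after [i] and after [i.+1]. The witness is
   [i.+1] if a is at most its counterpart on the right, [i] if a <= 1, and [i.+2] if b >= 1. *)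
case/or3P: hd => hd.
- by exists i.+1; rewrite ?(ltnW in2) // f1 f3 f5 f7; move: hd e0; clear; lia.
- by exists i; rewrite ?(ltnW (ltnW in2)) // f1 f5; move: hd e0; clear; lia.
- by exists i.+2; rewrite // -e2 f2 f6; move: hd; clear; lia.
Qed.

(** Only [D] itself lies below an initial segment [D], so the matroid has one basis. The term at the
    length of [D] attains the value; inclusion-exclusion bounds the others. *)
Lemma col_min_initial D S :
  (forall a b : 'I_n, (a <= b)%N -> b \in D -> a \in D) ->
  col_min D S = #|D :&: S|.
Proof.
move=> hD.
have cE (A : {set 'I_n}) : #|A| = (\sum_(r < n) (r \in A : nat))%N.
  by rewrite -sum1_card big_mkcond; apply: eq_bigr => r _; case: ifP.
apply/eqP; rewrite eqn_leq; apply/andP; split.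
  apply/bigmax_leqP => k _; rewrite leq_subLR cE.
  apply: (@leq_trans (count_below setT k + \sum_(r < n) (r \in D :&: S))); last first.
    by rewrite leq_add2r count_below_le.
  rewrite -!big_split; apply: leq_sum => r _; rewrite !inE.
  by case: (r < k)%N; case: (r \in D); case: (r \in S).
have [p pn pD] : exists2 p, (p <= n)%N & forall r : 'I_n, (r \in D) = (r < p)%N.
  have [r0 r0D|allD] := pickP [pred r | r \notin D]; last first.
    by exists n => // r; rewrite ltn_ord; have := allD r => /= /negbFE.
  have [r rD rmin] := arg_minnP (fun r : 'I_n => r : nat) r0D.
  exists r; first exact: ltnW.
  move=> j; apply/idP/idP => [jD|jr].
    by rewrite ltnNge; apply: contra rD => /hD; apply.
  by apply: contraLR jr => /rmin; rewrite -leqNgt.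
have cp k : (k <= p)%N -> count_below D k = k.
  elim: k => [|k IH] kp; first by rewrite /count_below big1.
  have kn := leq_trans kp pn.
  by rewrite (@count_belowS D (Ordinal kn)) /= IH 1?ltnW // pD /= kp addn1.
apply: leq_trans (col_min_ge _ _ pn); rewrite cp // addKn cE; apply: leq_sum => r _.
by rewrite inE pD.
Qed.

End SchubertMatroid.

(** * Isobaric divided differences *)

Section Tight.
Local Open Scope ring_scope.
Variable n : nat.
Implicit Types (i : 'I_n.-1) (S : {set 'I_n}) (mu : {set 'I_n} -> nat).
Implicit Types (f g : {mpoly int[n]}) (m o : 'X_{1..n}).

Definition weight m S : nat := (\sum_(k in S) m k)%N.

(* By the greedy algorithm, the last condition says that the Newton polytope  *)
(* of [f] is a generalized permutahedron with supermodular function [mu]:     *)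
(* every chain of sets is simultaneously tight at some exponent of [f].       *)
Definition tight f mu : Prop :=
  (forall m S, m \in msupp f -> (mu S <= weight m S)%N) /\
  (forall m, m \in msupp f -> weight m setT = mu setT) /\
  (forall s : seq 'I_n, perm_eq s (enum 'I_n) ->
     exists2 m, m \in msupp f &
       forall p q, s = p ++ q -> weight m [set x in p] = mu [set x in p]).

Lemma weight_split i m S :
  weight m S = ((lo i \in S) * m (lo i) + ((hi i \in S) * m (hi i) +
    \sum_(k | (k \in S) && ((k != lo i) && (k != hi i))) m k))%N.
Proof.
rewrite /weight (bigID (pred2 (lo i) (hi i))) /= addnA; congr (_ + _)%N; last first.
  by apply: eq_bigl => k; rewrite negb_or.
rewrite big_mkcond (bigD1 (lo i)) //= (bigD1 (hi i)) /=; last first.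
  by rewrite eq_sym lo_neq_hi.
rewrite big1 ?addn0 => [|k /andP[/negbTE-> /negbTE->]]; last by rewrite andbF.
rewrite eqxx andbT [hi i == lo i]eq_sym eqxx orbT andbT.
by case: (_ \in S); case: (_ \in S); rewrite ?mul1n.
Qed.

Lemma weight_switch i m S : weight (switch i m) S = weight m (swap_set i S).
Proof.
rewrite /weight [LHS](reindex_inj (@perm_inj _ (adj i))) /=.
by apply: eq_big => [k|k _]; rewrite ?inE // mnmE adjK.
Qed.

Lemma msym_X i k : msym (adj i) ('X_k : {mpoly int[n]}) = 'X_(adj i k).
Proof. by rewrite /msym mmapX mmap1U. Qed.

Lemma mcoeff_msym_adj i f m : (msym (adj i) f)@_m = f@_(switch i m).
Proof. exact: mcoeff_sym. Qed.

Lemma msym_adjK i f : msym (adj i) (msym (adj i) f) = f.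
Proof. by rewrite -msymMm /adj tperm2 msym1m. Qed.

Lemma msym_divdiff i f : msym (adj i) (divdiff i f) = divdiff i f.
Proof.
apply: divdiff_unique; apply: oppr_inj; rewrite -mulrN opprB.
have -> : 'X_(hi i) - 'X_(lo i) = msym (R := int) (adj i) ('X_(lo i) - 'X_(hi i)).
  by rewrite raddfB /= !msym_X adj_lo adj_hi.
by rewrite -msymM divdiffE msymB msym_adjK opprB.
Qed.

Lemma mcoeffMXU_eq0 f k m : m k = 0%N -> (f * 'X_k)@_m = 0.
Proof.
move=> mk; apply/eqP; rewrite mcoeff_eq0; apply/negP.
rewrite (perm_mem (msuppMX _ _)) => /mapP[m' _ em].
by move: mk; rewrite em mnmDE mnm1E eqxx.
Qed.

Definition same_line i m m' : Prop :=
  (forall k, k != lo i -> k != hi i -> m' k = m k) /\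
  (m' (lo i) + m' (hi i) = m (lo i) + m (hi i))%N.

Lemma same_line_weight i m m' S : (lo i \in S) = (hi i \in S) ->
  same_line i m m' -> weight m' S = weight m S.
Proof.
move=> eS [e1 e2]; rewrite !(weight_split i) eS !addnA -!mulnDr e2; congr (_ + _)%N.
by apply: eq_bigr => k /and3P[_ kl kh]; apply: e1.
Qed.

(** The hypothesis places [m] at or beyond the [lo i]-heavy end of the symmetrized support on its
    line. There only the monomial [m] of [f] itself contributes, with coefficient 1. *)
Lemma mcoeff_divdiff_extreme i f m :
  (forall m', m' \in msupp f -> same_line i m m' ->
     (m (hi i) <= m' (lo i))%N /\ (m (hi i) <= m' (hi i))%N) ->
  (divdiff i ('X_(lo i) * f))@_m = f@_m.
Proof.
have [lh hl] : (lo i == hi i) = false /\ (hi i == lo i) = false.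
  by split; rewrite 1?[hi i == _]eq_sym; apply: negbTE (lo_neq_hi i).
move eq: (m (hi i)) => q; elim: q m eq => [|q IH] m mq hm.
all: have := congr1 (mcoeff (U_(lo i) + m)) (divdiffE i ('X_(lo i) * f));
  rewrite mulrBr !mcoeffB mcoeffMX mcoeff_msym_adj.
all: rewrite [in X in _ = X](mulrC _ f) mcoeffMX.
  rewrite !mcoeffMXU_eq0 ?subr0 //.
    by rewrite mnmE adj_lo mnmDE mnm1E lh mq.
  by rewrite mnmDE mnm1E lh mq.
(* With g the divided difference, comparing coefficients at [U_(lo i) + m] gives g_m - g_m1 = f_m -
   f_m3, where [m3] is [m1] with its two coordinates switched. Both leave the allowed range, so f
   vanishes at them, and g_m1 vanishes by induction. *)
have -> : (U_(lo i) + m = U_(hi i) + (U_(lo i) + m - U_(hi i)))%MM.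
  apply/mnmP=> k; rewrite !mnmDE mnmBE mnmDE !mnm1E.
  by case: (eqVneq (hi i) k) => [<-|_]; rewrite ?lh ?mq; lia.
set m1 := (_ + m - _)%MM; rewrite mcoeffMX.
have m1E k : m1 k = (((lo i == k) + m k) - (hi i == k))%N by rewrite !mnmE.
set m2 := switch _ _; pose m3 := (m2 - U_(lo i))%MM.
have m3E k : m3 k = ((hi i == adj i k) + m1 (adj i k) - (lo i == k))%N.
  by rewrite !mnmE.
have m3other k : k != lo i -> k != hi i -> m3 k = m k.
  move=> kl kh; rewrite m3E m1E adj_other //.
  by rewrite ![_ == k]eq_sym (negbTE kl) (negbTE kh) !subn0.
have m3lo : m3 (lo i) = q by rewrite m3E m1E adj_lo !eqxx lh mq; lia.
have m3hi : m3 (hi i) = (m (lo i)).+1 by rewrite m3E m1E adj_hi hl lh eqxx; lia.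
have -> : m2 = (U_(lo i) + m3)%MM.
  apply/mnmP=> k; rewrite mnmDE mnmBE mnm1E.
  case: (eqVneq (lo i) k) => [<-|_]; rewrite ?subn0 //.
  by rewrite mnmE adj_lo mnmDE m1E mnm1E !eqxx lh mq; lia.
have m1lo : m1 (lo i) = (m (lo i)).+1 by rewrite m1E eqxx hl; lia.
have m1hi : m1 (hi i) = q by rewrite m1E eqxx lh mq; lia.
have m1other k : k != lo i -> k != hi i -> m1 k = m k.
  by move=> kl kh; rewrite m1E ![_ == k]eq_sym (negbTE kl) (negbTE kh) subn0.
rewrite mcoeffMX (IH m1) //; last first.
  move=> m' m'f [e1 e2]; have sl : same_line i m m'.
    split=> [k kl kh|]; first by rewrite e1 // m1other.
    by rewrite e2 m1lo m1hi mq; lia.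
  by have [] := hm m' m'f sl; lia.
have f1 : f@_m1 = 0.
  apply: memN_msupp_eq0; apply/negP => /hm[]; last by rewrite m1hi; lia.
  by split=> //; rewrite m1lo m1hi mq; lia.
have f3 : f@_m3 = 0.
  apply: memN_msupp_eq0; apply/negP => /hm[]; last by rewrite m3lo; lia.
  by split=> //; rewrite m3lo m3hi mq; lia.
by rewrite f1 f3 !subr0.
Qed.

(** On the line of [m], the bound of [mu] at [S] controls the coordinate [hi i], and its bound at
    [swap_set i S], at least as strong by dominance, controls [lo i]. So [m] is extreme. *)
Lemma mcoeff_divdiff_tight i f mu m S :
  tight f mu -> dominant i mu -> hi i \in S -> lo i \notin S ->
  (weight m S <= mu S)%N -> (divdiff i ('X_(lo i) * f))@_m = f@_m.
Proof.
move=> [ge _] dom hS lS le; apply: mcoeff_divdiff_extreme => m' m'f [e1 e2].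
have := dom (swap_set i S); rewrite !inE adj_lo adj_hi swap_setK => /(_ hS lS) le1.
have := leq_trans le (leq_trans le1 (ge m' (swap_set i S) m'f)).
have := leq_trans le (ge m' S m'f).
rewrite !(weight_split i) !inE adj_lo adj_hi hS (negbTE lS) !mul0n !mul1n !add0n.
have -> : (\sum_(k | (k \in swap_set i S) && ((k != lo i) && (k != hi i))) m' k =
   \sum_(k | (k \in S) && ((k != lo i) && (k != hi i))) m' k)%N.
  apply: eq_bigl => k; case: (boolP ((k != _) && _)); rewrite ?andbF // => /andP[kl kh].
  by rewrite inE adj_other.
have -> : (\sum_(k | (k \in S) && ((k != lo i) && (k != hi i))) m k =
   \sum_(k | (k \in S) && ((k != lo i) && (k != hi i))) m' k)%N.
  by apply: eq_bigr => k /and3P[_ kl kh]; rewrite e1.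
by rewrite !leq_add2r => h1 h2.
Qed.

(** Since the new polynomial is symmetric under [adj i], it suffices to treat sets and chains in
    which [lo i] does not come without or before [hi i]. There an exponent violating the bound would
    keep its coefficient in [f], which is zero, and a tight exponent of [f] keeps its nonzero
    coefficient. *)
Lemma tight_reflect i f mu : tight f mu -> dominant i mu ->
  tight (divdiff i ('X_(lo i) * f)) (reflect_mu i mu).
Proof.
move=> tf dom; have [ge [hom tt]] := tf; set G := divdiff _ _.
have symG m : (G@_(switch i m) = G@_m) by rewrite -mcoeff_msym_adj msym_divdiff.
have refl_good S : (lo i \in S) ==> (hi i \in S) -> reflect_mu i mu S = mu S.
  by rewrite /reflect_mu; case: (_ \in S) => //= ->.
have ge_good m S : m \in msupp G -> (lo i \in S) ==> (hi i \in S) ->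
    (mu S <= weight m S)%N.
  move=> mG hS; rewrite leqNgt; apply/negP => lt.
  suff e : G@_m = f@_m.
    move: mG; rewrite mcoeff_msupp e -mcoeff_msupp => /(ge _ S).
    by rewrite leqNgt lt.
  have [hlS|ehl] := boolP ((hi i \in S) && (lo i \notin S)).
    by have [h l] := andP hlS; apply: mcoeff_divdiff_tight (ltnW lt).
  have {ehl}eS : (lo i \in S) = (hi i \in S).
    by move: hS ehl; case: (lo i \in S); case: (hi i \in S).
  apply: mcoeff_divdiff_extreme => m' m'f [e1 e2].
  by move: (ge m' S m'f); rewrite (same_line_weight eS (conj e1 e2)) leqNgt lt.
split=> [m S mG|].
  rewrite /reflect_mu; case: ifP => [/andP[lS hS]|/negbT]; last first.
    by rewrite negb_and negbK -implybE; apply: ge_good.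
  have mG' : switch i m \in msupp G by rewrite mcoeff_msupp symG -mcoeff_msupp.
  have := ge_good _ (swap_set i S) mG'.
  rewrite weight_switch swap_setK; apply.
  by rewrite !inE adj_lo adj_hi lS (negbTE hS).
split=> [m mG|s ps].
  rewrite refl_good ?inE //; apply: contraTeq mG => ne.
  have mf : m \notin msupp f by apply: contra ne => /hom ->.
  rewrite mcoeff_msupp negbK mcoeff_divdiff_extreme ?memN_msupp_eq0 //.
  move=> m' m'f sl; case/eqP: ne; rewrite -(hom _ m'f).
  by rewrite (same_line_weight _ sl) // !inE.
have caseA t : perm_eq t (enum 'I_n) -> (index (hi i) t < index (lo i) t)%N ->
    exists2 m, m \in msupp G &
    forall p q, t = p ++ q -> weight m [set x in p] = reflect_mu i mu [set x in p].
  move=> pt hl; have [m mf hm] := tt t pt.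
  have ut : uniq t by rewrite (perm_uniq pt) enum_uniq.
  have int k : k \in t by rewrite (perm_mem pt) mem_enum.
  have inp p q k : t = p ++ q -> (k \in p) = (index k t < size p)%N.
    move=> et; rewrite et index_cat; case: ifP => kp; first by rewrite index_mem kp.
    by rewrite ltnNge leq_addr.
  exists m => [|p q et]; last first.
    rewrite refl_good ?(hm _ _ et) // !inE !(inp _ _ _ et).
    by apply/implyP; apply: ltn_trans.
  have ec := esym (cat_take_drop (index (lo i) t) t).
  have sz : size (take (index (lo i) t) t) = index (lo i) t.
    by rewrite size_takel // ltnW // index_mem.
  rewrite mcoeff_msupp -/G (@mcoeff_divdiff_tight i f mu m [set x in take (index (lo i) t) t]) //.
  - by rewrite -mcoeff_msupp.
  - by rewrite inE (inp _ _ _ ec) sz.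
  - by rewrite inE (inp _ _ _ ec) sz ltnn.
  - by rewrite (hm _ _ ec).
have int k : k \in s by rewrite (perm_mem ps) mem_enum.
have [|le] := ltnP (index (hi i) s) (index (lo i) s); first exact: caseA.
(* The support of [G] is closed under [switch i], so a chain with [lo i] first is handled through
   its mirror image. *)
have [||m mG hm] := caseA [seq adj i k | k <- s].
- apply: uniq_perm; rewrite ?enum_uniq ?map_inj_uniq //; try exact: perm_inj.
    by rewrite (perm_uniq ps) enum_uniq.
  by move=> k; rewrite mem_enum -[k](adjK i) mem_map ?int //; exact: perm_inj.
- rewrite -(adj_lo i) -{2}(adj_hi i) !index_map; try exact: perm_inj.
  rewrite ltn_neqAle le andbT; apply/negP => /eqP e.
  by move: (lo_neq_hi i); rewrite -(nth_index (lo i) (int (lo i))) e nth_index ?eqxx.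
exists (switch i m) => [|p q es]; first by rewrite mcoeff_msupp symG -mcoeff_msupp.
have := hm (map (adj i) p) (map (adj i) q); rewrite es map_cat => /(_ erefl).
have -> : [set x in map (adj i) p] = swap_set i [set x in p].
  by apply/setP=> k; rewrite !inE -{1}[k](adjK i) mem_map //; exact: perm_inj.
by rewrite weight_switch reflect_mu_swap.
Qed.

End Tight.

(** * Sums of column functions and key polynomials *)

Section TightTropical.
Local Open Scope ring_scope.
Variable n : nat.
Implicit Types (i : 'I_n.-1) (S D : {set 'I_n}) (mu : {set 'I_n} -> nat).
Implicit Types (f g : {mpoly int[n]}) (m o al : 'X_{1..n}) (Ds : seq {set 'I_n}).

Definition tight_tropical f mu : Prop := tight f mu /\ tropical mu.

Lemma sum_ltn (N c : nat) : (\sum_(j < N) (j < c)%N = minn c N)%N.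
Proof.
elim: N => [|N IH]; first by rewrite big_ord0 minn0.
by rewrite big_ord_recr IH /=; lia.
Qed.

Lemma weightD m o S : weight (m + o) S = (weight m S + weight o S)%N.
Proof. by rewrite /weight -big_split; apply: eq_bigr => k _; rewrite mnmDE. Qed.

Lemma mem_msupp_mulX f o m :
  reflect (exists2 m', m' \in msupp f & m = (o + m')%MM) (m \in msupp ('X_[o] * f)).
Proof. by rewrite mulrC (perm_mem (msuppMX _ _)); apply: mapP. Qed.

(** Multiplication by a monomial translates the exponents and adds a modular function to [mu]. Both
    directions serve the Schubert step: one strips a monomial, the other restores a smaller one. *)
Lemma tight_tropical_mulX f o mu :
  tight_tropical ('X_[o] * f) (fun S => weight o S + mu S)%N <-> tight_tropical f mu.
Proof.
rewrite /tight_tropical -(tropical_addl o mu).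
split=> -[[ge [hom tt]] mv]; split=> //; split; try split.
- move=> m S mf; have /(ge _ S) : (o + m)%MM \in msupp ('X_[o] * f).
    by apply/mem_msupp_mulX; exists m.
  by rewrite weightD leq_add2l.
- move=> m mf; have /hom : (o + m)%MM \in msupp ('X_[o] * f).
    by apply/mem_msupp_mulX; exists m.
  by rewrite weightD => /addnI.
- move=> s ps; have [_ /mem_msupp_mulX[m mf ->] hm] := tt s ps.
  exists m => // p q es; apply/eqP; rewrite -(eqn_add2l (weight o [set x in p])).
  by rewrite -weightD (hm _ _ es).
- by move=> _ S /mem_msupp_mulX[m mf ->]; rewrite weightD leq_add2l ge.
- by move=> _ /mem_msupp_mulX[m mf ->]; rewrite weightD (hom _ mf).
- move=> s ps; have [m mf hm] := tt s ps; exists (o + m)%MM.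
    by apply/mem_msupp_mulX; exists m.
  by move=> p q es; rewrite weightD (hm _ _ es).
Qed.

Lemma tight_factor f mu o : tight f mu -> (forall k, (o k <= mu [set k])%N) ->
  exists g, f = 'X_[o] * g.
Proof.
move=> [ge _] le; exists (\sum_(m <- msupp f) f@_m *: 'X_[m - o]).
rewrite mulr_sumr {1}[f]mpolyE; apply: eq_big_seq => m mf.
rewrite -scalerAr -mpolyXD addmC submK //; apply/mnm_lepP => k.
by apply: leq_trans (le k) _; rewrite (leq_trans (ge _ _ mf)) // /weight big_set1.
Qed.

Lemma tight_tropical_monomial o : tight_tropical 'X_[o] (weight o).
Proof.
split.
  split=> [m S|]; first by rewrite msuppX inE => /eqP->.
  split=> [m|s _]; first by rewrite msuppX inE => /eqP->.
  by exists o; rewrite ?msuppX ?inE.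
have /(tropical_addl o) : tropical (fun _ : {set 'I_n} => 0%N) by [].
by congr tropical; apply: funext => S; rewrite addn0.
Qed.

Definition cols_min Ds S : nat := (\sum_(D <- Ds) col_min D S)%N.

(** The branch taken by [reflect_mu] depends on [S] alone, so reflection commutes with the sum over
    columns. *)
Lemma tight_tropical_reflect_cols i f Ds : tight_tropical f (cols_min Ds) ->
  (forall D, D \in Ds -> (hi i \in D) ==> (lo i \in D)) ->
  tight_tropical (divdiff i ('X_(lo i) * f)) (cols_min [seq swap_set i D | D <- Ds]).
Proof.
move=> [tf mv] hD.
have dom : dominant i (cols_min Ds).
  by move=> S lS hS; apply: leq_sum => D _; apply: col_min_dominant.
have -> : cols_min [seq swap_set i D | D <- Ds] = reflect_mu i (cols_min Ds).
  apply: funext => S; rewrite /cols_min big_map.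
  rewrite (eq_big_seq (fun D => reflect_mu i (col_min D) S)) => [|D /hD].
    by rewrite /reflect_mu; case: ifP.
  exact: col_min_swap.
by split; [apply: tight_reflect | apply: tropical_reflect].
Qed.

Lemma tight_tropical_initial_cols o Ds :
  (forall D (a b : 'I_n), D \in Ds -> (a <= b)%N -> b \in D -> a \in D) ->
  (forall k, o k = \sum_(D <- Ds) (k \in D))%N -> tight_tropical 'X_[o] (cols_min Ds).
Proof.
move=> hD ho; suff -> : cols_min Ds = weight o by apply: tight_tropical_monomial.
apply: funext => S; rewrite /cols_min /weight (eq_bigr _ (fun k _ => ho k)).
rewrite exchange_big; apply: eq_big_seq => D DDs.
rewrite col_min_initial => [|a b]; last exact: hD.
rewrite -sum1_card big_mkcond [RHS]big_mkcond; apply: eq_bigr => k _.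
by rewrite inE; case: (k \in D); case: (k \in S).
Qed.

(** The columns of a weakly decreasing [al] are initial segments. At an ascent of [al], every column
    of [switch i al] that contains [hi i] contains [lo i]. A common bound [N] keeps the number of
    columns fixed along the recursion. *)
Lemma tight_tropical_key al f N : is_key al f -> (forall k, (al k <= N)%N) ->
  tight_tropical f (cols_min [seq [set k | (j < al k)%N] | j <- iota 0 N]).
Proof.
elim=> {al f} [al dec|al i f lt kf IH] leN.
  apply: tight_tropical_initial_cols => [D a b /mapP[j _ ->] ab|k].
    by rewrite !inE => /leq_trans; apply; apply: dec.
  rewrite big_map -[N in iota 0 N]subn0 -/(index_iota 0 N) big_mkord.
  under eq_bigr do rewrite inE.
  by rewrite sum_ltn (minn_idPl (leN k)).
have {}IH := IH _; have -> : [seq [set k | (j < al k)%N] | j <- iota 0 N] =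
   [seq swap_set i D | D <- [seq [set k | (j < switch i al k)%N] | j <- iota 0 N]].
  rewrite -map_comp; apply: eq_map => j /=; apply/setP=> k.
  by rewrite !inE mnmE adjK.
apply: tight_tropical_reflect_cols; first by apply: IH => k; rewrite mnmE.
move=> D /mapP[j _ ->]; rewrite !inE !mnmE adj_lo adj_hi; apply/implyP => h.
exact: ltn_trans lt.
Qed.

End TightTropical.

(** * Schubert polynomials *)

Section DivdiffRelations.
Local Open Scope ring_scope.
Variable n : nat.
Implicit Types (i j : 'I_n.-1) (f g : {mpoly int[n]}).

Lemma subXX_neq0 (a b : 'I_n) : a != b -> 'X_a - 'X_b != 0 :> {mpoly int[n]}.
Proof.
move=> ab; apply/eqP => /(congr1 (mcoeff U_(a)%MM)) /eqP.
by rewrite mcoeffB !mcoeffXU mcoeff0 eqxx [b == a]eq_sym (negbTE ab) oner_eq0.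
Qed.

Lemma msym_adj_comm i j f : (i.+1 < j)%N ->
  msym (adj i) (msym (adj j) f) = msym (adj j) (msym (adj i) f).
Proof.
move=> ij; rewrite -!msymMm; congr (msym _ f).
suff e : (adj i ^ adj j)%g = adj i by rewrite [RHS]conjgC e.
by rewrite {1 3}/adj tpermJ !adj_other // -val_eqE /=; lia.
Qed.

Lemma adj_braid i j : (i.+1 = j :> nat)%N ->
  (adj i * adj j * adj i = adj j * adj i * adj j)%g.
Proof.
move=> ij; apply/permP=> k; rewrite !permM.
have e : lo j = hi i by apply: val_inj; rewrite /= ij.
have h1 : lo i != hi j by rewrite -val_eqE /=; lia.
have h2 := lo_neq_hi i; have h3 := lo_neq_hi j; rewrite e in h3.
have ai k' := @adj_other n i k'; have aj k' := @adj_other n j k'; rewrite e in aj.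
have a1 := adj_lo i; have a2 := adj_hi i; have a3 := adj_lo j; have a4 := adj_hi j.
rewrite e in a3 a4.
have a5 : adj i (hi j) = hi j by rewrite ai // eq_sym.
have a6 : adj j (lo i) = lo i by rewrite aj.
have [->|k1] := eqVneq k (lo i); first by rewrite a1 a3 a5 a6 a1 a3.
have [->|k2] := eqVneq k (hi i); first by rewrite a2 a6 a1 a3 a5 a4.
have [->|k3] := eqVneq k (hi j); first by rewrite a5 a4 a2 a6.
by rewrite !(ai, aj).
Qed.

(** Here q and r are successive divided differences of p by commuting reflections t and s, with
    denominators b and a; a prefix s or t on a name means applying that reflection. *)
Lemma alternating_sum2 (A : comPzRingType) (a b p sp tp stp q sq r : A) :
  q * b = p - tp -> sq * b = sp - stp -> r * a = q - sq ->
  r * (a * b) = p - (sp + tp) + stp.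
Proof.
move=> Eq Esq Er; rewrite mulrA Er mulrBl Eq Esq; ring.
Qed.

Lemma alternating_sum2C (V : zmodType) (p x y z z' : V) :
  z = z' -> p - (x + y) + z = p - (y + x) + z'.
Proof. by move=> ->; rewrite [x + y]addrC. Qed.

Lemma divdiff_comm i j f : (i.+1 < j)%N ->
  divdiff i (divdiff j f) = divdiff j (divdiff i f).
Proof.
move=> ij.
have adjne k k' : (k' != lo k) -> k' != hi k -> adj k k' = k' by apply: adj_other.
have sij : msym (adj i) ('X_(lo j) - 'X_(hi j)) = 'X_(lo j) - 'X_(hi j) :> {mpoly int[n]}.
  by rewrite raddfB /= !msym_X !adjne // -val_eqE /=; lia.
have sji : msym (adj j) ('X_(lo i) - 'X_(hi i)) = 'X_(lo i) - 'X_(hi i) :> {mpoly int[n]}.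
  by rewrite raddfB /= !msym_X !adjne // -val_eqE /=; lia.
have ne := mulf_neq0 (subXX_neq0 (lo_neq_hi i)) (subXX_neq0 (lo_neq_hi j)).
apply: (mulIf ne).
have Ej := congr1 (msym (adj i)) (divdiffE j f).
rewrite msymM sij raddfB /= in Ej.
have Ei := congr1 (msym (adj j)) (divdiffE i f).
rewrite msymM sji raddfB /= in Ei.
have h1 := alternating_sum2 (divdiffE j f) Ej (divdiffE i (divdiff j f)).
have h2 := alternating_sum2 (divdiffE i f) Ei (divdiffE j (divdiff i f)).
have {}h2 := etrans (congr1 (fun x => divdiff j (divdiff i f) * x) (mulrC _ _)) h2.
apply: etrans h1 _; apply: esym; apply: etrans h2 _.
exact: alternating_sum2C (esym (msym_adj_comm f ij)).
Qed.

(** Here q, r, t are the successive divided differences of p by s, then t, then s; prefixes again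
    denote applied reflections. The reflection s exchanges the roots b and c, while t exchanges a
    and c. *)
Lemma alternating_sum (A : comPzRingType)
    (a b c p sp tp tsp stp stsp q sq tq stq r sr t : A) :
  c = a + b -> sq = q -> q * a = p - sp -> r * b = q - tq -> t * a = r - sr ->
  sr * c = sq - stq -> tq * c = tp - tsp -> stq * b = stp - stsp ->
  t * (a * c * b) = p - sp - tp + (tsp + stp) - stsp.
Proof.
move=> -> -> Eq Er Et Esr Etq Estq.
have -> : t * (a * (a + b) * b) = t * a * (a + b) * b by ring.
rewrite Et.
have -> : (r - sr) * (a + b) * b = r * b * (a + b) - sr * (a + b) * b by ring.
rewrite Er Esr.
have -> : (q - tq) * (a + b) - (q - stq) * b = q * a - tq * (a + b) + stq * b by ring.
by rewrite Eq Etq Estq; ring.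
Qed.

Lemma alternating_sumC (V : zmodType) (p x y z w t t' : V) :
  t = t' -> p - x - y + (z + w) - t = p - y - x + (w + z) - t'.
Proof. by move=> ->; rewrite [z + w]addrC (addrAC p). Qed.

Lemma divdiff_braid i j f : (i.+1 = j :> nat)%N ->
  divdiff i (divdiff j (divdiff i f)) = divdiff j (divdiff i (divdiff j f)).
Proof.
move=> ij.
have e : lo j = hi i by apply: val_inj; rewrite /= ij.
have h1 : lo i != hi j by rewrite -val_eqE /=; lia.
have h2 := lo_neq_hi i; have h3 := lo_neq_hi j; rewrite e in h3.
have a1 := adj_lo i; have a2 := adj_hi i; have a3 := adj_lo j; have a4 := adj_hi j.
rewrite e in a3 a4.
have a5 : adj i (hi j) = hi j by rewrite adj_other // eq_sym.
have a6 : adj j (lo i) = lo i by rewrite adj_other // e.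
have [a ea] : {a : {mpoly int[n]} | a = 'X_(lo i) - 'X_(hi i)} by eexists.
have [b eb] : {b : {mpoly int[n]} | b = 'X_(hi i) - 'X_(hi j)} by eexists.
have [c ec] : {c : {mpoly int[n]} | c = 'X_(lo i) - 'X_(hi j)} by eexists.
have ne : a * c * b != 0 by rewrite ea eb ec !mulf_neq0 ?subXX_neq0.
have Ei (p : {mpoly int[n]}) : divdiff i p * a = p - msym (adj i) p.
  by rewrite ea; apply: divdiffE.
have Ej (p : {mpoly int[n]}) : divdiff j p * b = p - msym (adj j) p.
  by rewrite eb -e; apply: divdiffE.
have ib : msym (adj i) b = c by rewrite eb ec raddfB /= !msym_X a2 a5.
have ic : msym (adj i) c = b by rewrite eb ec raddfB /= !msym_X a1 a5.
have ja : msym (adj j) a = c by rewrite ea ec raddfB /= !msym_X a3 a6.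
have jc : msym (adj j) c = a by rewrite ea ec raddfB /= !msym_X a4 a6.
have abc : c = a + b by rewrite ea eb ec; ring.
(* Both sides times the Vandermonde product are the alternating sum of the    *)
(* images of [f] under the six permutations.                                  *)
apply: (mulIf ne).
have sEj p : msym (adj i) (divdiff j p) * c =
    msym (adj i) p - msym (adj i) (msym (adj j) p).
  by have := congr1 (msym (adj i)) (Ej p); rewrite msymM ib raddfB.
have sEi p : msym (adj j) (divdiff i p) * c =
    msym (adj j) p - msym (adj j) (msym (adj i) p).
  by have := congr1 (msym (adj j)) (Ei p); rewrite msymM ja raddfB.
have ssEj p : msym (adj j) (msym (adj i) (divdiff j p)) * a =
    msym (adj j) (msym (adj i) p) - msym (adj j) (msym (adj i) (msym (adj j) p)).
  by have := congr1 (msym (adj j)) (sEj p); rewrite msymM jc raddfB.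
have ssEi p : msym (adj i) (msym (adj j) (divdiff i p)) * b =
    msym (adj i) (msym (adj j) p) - msym (adj i) (msym (adj j) (msym (adj i) p)).
  by have := congr1 (msym (adj i)) (sEi p); rewrite msymM ic raddfB.
have bac : c = b + a by rewrite abc addrC.
have A1 := alternating_sum abc (msym_divdiff i f) (Ei f) (Ej _) (Ei _)
  (sEj _) (sEi f) (ssEi f).
have A2 := alternating_sum bac (msym_divdiff j f) (Ej f) (Ei _) (Ej _)
  (sEi _) (sEj f) (ssEj f).
have e3 : b * c * a = a * c * b by ring.
rewrite e3 in A2; apply: etrans A1 _; apply: esym; apply: etrans A2 _.
have e6 : msym (adj j) (msym (adj i) (msym (adj j) f)) =
    msym (adj i) (msym (adj j) (msym (adj i) f)).
  by rewrite -!msymMm !mulgA (adj_braid ij).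
by apply: alternating_sumC e6.
Qed.

End DivdiffRelations.

(** * The Schubert recursion and independence of the reduced word *)

Section Schubert.
Local Open Scope ring_scope.
Variable n : nat.
Implicit Types (i j : 'I_n.-1) (f g : {mpoly int[n]}) (w : {perm 'I_n}).
Implicit Types (t : seq 'I_n.-1).

Definition noninv_set w : {set 'I_n * 'I_n} :=
  [set p : 'I_n * 'I_n | (p.1 < p.2)%N && (w p.1 < w p.2)%N].

(** This is the length of [w^-1 w_0], hence the number of divided differences in X(w). *)
Definition noninv w : nat := #|noninv_set w|.

Lemma adj_mulK i w : (adj i * (adj i * w) = w)%g.
Proof. by rewrite mulgA tperm2 mul1g. Qed.

(** Applying [adj i] to both positions matches the noninversions of [adj i * w] with those of [w]
    other than [(lo i, hi i)]. *)
Lemma noninv_ascent i w : (w (lo i) < w (hi i))%N ->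
  noninv w = (noninv (adj i * w)%g).+1.
Proof.
move=> wi; pose s (p : 'I_n * 'I_n) := (adj i p.1, adj i p.2).
have sK : involutive s by case=> a b; rewrite /s /= !adjK.
have im (A : {set 'I_n * 'I_n}) p : (p \in s @: A) = (s p \in A).
  by rewrite -{1}[p]sK (mem_imset _ _ (inv_inj sK)).
have -> : noninv w = #|(lo i, hi i) |: s @: noninv_set (adj i * w)%g|.
  congr #|pred_of_set _|; apply/setP=> -[a b].
  rewrite in_setU1 im !inE /= !permM !adjK.
  rewrite xpair_eqE; case: (boolP ((a == lo i) && (b == hi i))) => [/andP[/eqP-> /eqP->]|ne] /=.
    by rewrite wi ltnSn.
  apply/andP/andP => -[h h2]; split=> //; first exact: adj_lt.
  rewrite -[a](adjK i) -[b](adjK i); apply: adj_lt => //.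
  apply: contraTN h2 => /andP[/eqP ha /eqP hb].
  by rewrite -[a](adjK i) -[b](adjK i) ha hb adj_lo adj_hi -leqNgt ltnW.
rewrite cardsU1 (card_imset _ (inv_inj sK)) -add1n; congr (_ + _)%N.
rewrite im !inE /= adj_lo adj_hi.
by rewrite ltnNge leqnSn.
Qed.

Lemma noninv_descent i w : (w (hi i) < w (lo i))%N ->
  noninv (adj i * w)%g = (noninv w).+1.
Proof.
move=> wi; rewrite (@noninv_ascent i) ?adj_mulK //.
by rewrite !permM adj_lo adj_hi.
Qed.

Lemma ascent_or_descent i w : (w (lo i) < w (hi i))%N \/ (w (hi i) < w (lo i))%N.
Proof.
apply/orP; rewrite -neq_ltn (inj_eq val_inj) (inj_eq perm_inj).
exact: lo_neq_hi.
Qed.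

Lemma noninv_longest : noninv (longest_perm n) = 0%N.
Proof.
apply/eqP; rewrite cards_eq0; apply/eqP/setP=> -[a b]; rewrite !inE !permE /=.
by apply/negbTE; have := ltn_ord a; have := ltn_ord b; lia.
Qed.

Lemma no_ascent w : (forall i, ~~ (w (lo i) < w (hi i))%N) -> w = longest_perm n.
Proof.
move=> na; have dec i : (w (hi i) < w (lo i))%N.
  by case: (ascent_or_descent i w) => // h; have := na i; rewrite h.
have ub d : forall k : 'I_n, k = d :> nat -> (w k + d < n)%N.
  elim: d => [|d IH] k kd; first by rewrite addn0.
  have dn : (d < n.-1)%N by have := ltn_ord k; lia.
  have := IH (lo (Ordinal dn)) erefl; have := dec (Ordinal dn).
  rewrite (_ : hi _ = k); last exact: val_inj.
  lia.
have lb d : forall k : 'I_n, (k + d).+1 = n -> (d <= w k)%N.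
  elim: d => [//|d IH] k kd.
  have dn : (k < n.-1)%N by lia.
  have := IH (hi (Ordinal dn)); have := dec (Ordinal dn).
  rewrite (_ : lo _ = k); last exact: val_inj.
  by rewrite /=; lia.
apply/permP=> k; apply: val_inj; rewrite permE /=.
have := ub k k erefl; have := lb (n - k.+1)%N k; have := ltn_ord k; lia.
Qed.

(** Not the Lehmer code, but the permutation w^-1 w_0 whose reduced words compute X(w). *)
Definition code w : {perm 'I_n} := Defs.pcomp w^-1%g (longest_perm n).

Lemma code_adj i w : Defs.pcomp (adj i) (code w) = code (adj i * w)%g.
Proof. by rewrite /code /Defs.pcomp invMg mulgA /adj tpermV. Qed.

Lemma word_perm_code i t w :
  word_perm (i :: t) = code w -> word_perm t = code (adj i * w)%g.
Proof.
by move=> e; rewrite -code_adj -e /= /Defs.pcomp -mulgA tperm2 mulg1.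
Qed.

Lemma noninv_le_size t w : word_perm t = code w -> (noninv w <= size t)%N.
Proof.
elim: t w => [|i t IH] w e.
  suff -> : w = longest_perm n by rewrite noninv_longest.
  by rewrite -[w]mul1g; move: e; rewrite /= /code /Defs.pcomp => ->; rewrite mulgKV.
have /IH := word_perm_code e; rewrite /=.
by case: (ascent_or_descent i w) => [/noninv_ascent|/noninv_descent] ->; lia.
Qed.

Lemma exists_ascent w : noninv w != 0%N -> exists i, (w (lo i) < w (hi i))%N.
Proof.
have [i hi _|na] := pickP (fun i => w (lo i) < w (hi i))%N; first by exists i.
rewrite (no_ascent (w := w)) ?noninv_longest // => i; exact: negbT (na i).
Qed.

Lemma exists_noninv_word w : exists2 t, word_perm t = code w & size t = noninv w.
Proof.
move e: (noninv w) => k; elim: k w e => [|k IH] w e.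
  exists [::] => //; rewrite /= /code /Defs.pcomp (@no_ascent w) ?mulgV // => i.
  by apply/negP => /noninv_ascent; rewrite e.
have [|i hi] := exists_ascent (w := w); first by rewrite e.
have := noninv_ascent hi; rewrite e => -[/esym /IH [t et st]].
exists (i :: t); rewrite /= ?st //.
by rewrite et code_adj adj_mulK.
Qed.

Lemma reduced_word_size t w : reduced_word t (code w) -> size t = noninv w.
Proof.
move=> [et min]; apply/eqP; rewrite eqn_leq noninv_le_size // andbT.
by have [t' et' <-] := exists_noninv_word w; apply: min.
Qed.

(** The recursion X(w) = d_i X(w s_i) at an arbitrary ascent [i]; in the product convention of the
    library w s_i is [adj i * w]. *)
Inductive schubert_rec : {perm 'I_n} -> {mpoly int[n]} -> Prop :=
| schubert_longest : schubert_rec (longest_perm n) 'X_[staircase n]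
| schubert_ascent w i f : (w (lo i) < w (hi i))%N ->
    schubert_rec (adj i * w)%g f -> schubert_rec w (divdiff i f).

(** The first letter of a reduced word is an ascent: at a descent, the remaining word would be
    shorter than the number of noninversions it has to account for. *)
Lemma is_schubert_rec w f : is_schubert w f -> schubert_rec w f.
Proof.
move=> [t rt ->]; elim: t w rt => [|i t IH] w rt.
  have := reduced_word_size rt; move/esym/eqP; rewrite /= => n0.
  rewrite (@no_ascent w); first exact: schubert_longest.
  by move=> i; apply/negP => /noninv_ascent e; rewrite e in n0.
have sz := reduced_word_size rt; have [et _] := rt.
have et' := word_perm_code et.
have wi : (w (lo i) < w (hi i))%N.
  case: (ascent_or_descent i w) => // /noninv_descent e.
  by have := noninv_le_size et'; rewrite e -sz /= ltnNge leqnSn.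
apply: (schubert_ascent wi); apply: IH; split=> // t' et''.
by rewrite -ltnS -[(size t).+1]/(size (i :: t)) sz (noninv_ascent wi) ltnS noninv_le_size.
Qed.

Lemma exists_schubert_rec w : exists f, schubert_rec w f.
Proof. by have [f /is_schubert_rec] := exists_schubert w; exists f. Qed.

Lemma schubert_recP w f : schubert_rec w f ->
  (w = longest_perm n /\ f = 'X_[staircase n]) \/
  exists i g, [/\ (w (lo i) < w (hi i))%N, schubert_rec (adj i * w)%g g & f = divdiff i g].
Proof. by case=> [|{}w i {}f wi hf]; [left | right; exists i, f]. Qed.

Lemma longest_no_ascent i : ~~ (longest_perm n (lo i) < longest_perm n (hi i))%N.
Proof. by apply/negP => /noninv_ascent; rewrite noninv_longest. Qed.

(** A diamond argument by induction on noninversions: two ascents [i] and [j] of [w] lead to a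
    common permutation further along, after two steps if they are far apart and after three if
    adjacent. The relations [divdiff_comm] and [divdiff_braid] then identify the results. *)
Lemma schubert_rec_unique w f g : schubert_rec w f -> schubert_rec w g -> f = g.
Proof.
have [k] := ubnP (noninv w); elim: k w f g => // k IH w f g; rewrite ltnS => wk.
move=> /schubert_recP[[ew ef]|[i [f1 [wi hf1 ef]]]];
  move=> /schubert_recP[[ew' eg]|[j [g1 [wj hg1 eg]]]].
- by rewrite ef eg.
- by move: (longest_no_ascent j); rewrite -ew wj.
- by move: (longest_no_ascent i); rewrite -ew' wi.
wlog ij : i j f g f1 g1 wi hf1 ef wj hg1 eg / (i <= j)%N.
  move=> W; case: (leqP i j) => [|/ltnW] ij; first exact: (W i j f g f1 g1).
  by symmetry; apply: (W j i g f g1 f1).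
have down l (v : {perm 'I_n}) p q : (noninv v < k)%N -> schubert_rec v p ->
    (v (lo l) < v (hi l))%N -> schubert_rec (adj l * v)%g q -> p = divdiff l q.
  by move=> vk hp vl hq; apply: IH hp (schubert_ascent vl hq).
have nk l : (w (lo l) < w (hi l))%N -> (noninv (adj l * w)%g < k)%N.
  by move=> wl; rewrite -ltnS -noninv_ascent // ltnS.
case: (ltngtP i j) ij => // [ij _|ij _]; last first.
  have eij : i = j by apply: val_inj.
  by rewrite ef eg -eij; congr divdiff; apply: IH (nk _ wi) hf1 _; rewrite eij.
have [ij1|ij1] := ltnP i.+1 j.
  have [h hh] := exists_schubert_rec (adj j * (adj i * w))%g.
  have cij : (adj j * (adj i * w) = adj i * (adj j * w))%g.
    rewrite !mulgA; congr (_ * _)%g.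
    suff e : (adj i ^ adj j)%g = adj i by rewrite [RHS]conjgC e.
    by rewrite {1 3}/adj tpermJ !adj_other // -val_eqE /=; lia.
  have wij : ((adj i * w)%g (lo j) < (adj i * w)%g (hi j))%N.
    by rewrite !permM !adj_other // -val_eqE /=; lia.
  have wji : ((adj j * w)%g (lo i) < (adj j * w)%g (hi i))%N.
    by rewrite !permM !adj_other // -val_eqE /=; lia.
  have ef1 : f1 = divdiff j h by apply: down (nk _ wi) hf1 wij hh.
  have eg1 : g1 = divdiff i h by apply: down (nk _ wj) hg1 wji _; rewrite -cij.
  by rewrite ef eg ef1 eg1; apply: divdiff_comm.
have {ij ij1} ij : i.+1 = j :> nat by apply/eqP; rewrite eqn_leq ij ij1.
have e : lo j = hi i by apply: val_inj; rewrite /= ij.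
have a1 := adj_lo i; have a2 := adj_hi i; have a3 := adj_lo j; have a4 := adj_hi j.
have a5 : adj i (hi j) = hi j by rewrite adj_other // -val_eqE /=; lia.
have a6 : adj j (lo i) = lo i by rewrite adj_other // -val_eqE /=; lia.
rewrite e in a3 a4 wj.
(* The polynomial [h] sits at the common end of the two three-step paths; [p] and [q] below sit one
   step before it. *)
have [h hh] := exists_schubert_rec (adj i * (adj j * (adj i * w)))%g.
have hh' : schubert_rec (adj j * (adj i * (adj j * w)))%g h.
  by rewrite !mulgA -adj_braid // -!mulgA.
have [p hp] := exists_schubert_rec (adj j * (adj i * w))%g.
have [q hq] := exists_schubert_rec (adj i * (adj j * w))%g.
have wij : ((adj i * w)%g (lo j) < (adj i * w)%g (hi j))%N.
  by rewrite !permM e a2 a5 (ltn_trans wi).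
have wji : ((adj j * w)%g (lo i) < (adj j * w)%g (hi i))%N.
  by rewrite !permM a3 a6 (ltn_trans wi).
have wj' : (w (lo j) < w (hi j))%N by rewrite e.
have ef1 : f1 = divdiff j p by apply: down (nk _ wi) hf1 wij hp.
have eg1 : g1 = divdiff i q by apply: down (nk _ wj') hg1 wji hq.
have np : (noninv (adj j * (adj i * w))%g < k)%N.
  by have := nk _ wi; rewrite (noninv_ascent wij); apply: leq_trans.
have nq : (noninv (adj i * (adj j * w))%g < k)%N.
  by have := nk _ wj'; rewrite (noninv_ascent wji); apply: leq_trans.
have ep : p = divdiff i h.
  by apply: down np hp _ hh; rewrite !permM a6 a1 a3 a5.
have eq : q = divdiff j h.
  by apply: down nq hq _ hh'; rewrite !permM e a2 a6 a5 a4.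
by rewrite ef eg ef1 eg1 ep eq; apply: divdiff_braid.
Qed.

End Schubert.

(** * Columns of the Rothe diagram *)

Section SchubertColumns.
Local Open Scope ring_scope.
Variable n : nat.
Implicit Types (i : 'I_n.-1) (j k r : 'I_n) (f g : {mpoly int[n]}) (w : {perm 'I_n}).

Definition rothe w j : {set 'I_n} := [set r | (j < w r)%N && (r < w^-1%g j)%N].

Definition initial_mnm (c : nat) : 'X_{1..n} := [multinom (k < c)%N : nat | k < n].

Lemma weight_initial c S :
  weight (initial_mnm c) S = col_min [set r : 'I_n | (r < c)%N] S.
Proof.
rewrite col_min_initial => [|a b ab]; last by rewrite !inE; apply: leq_ltn_trans.
rewrite /weight -sum1_card big_mkcond [RHS]big_mkcond; apply: eq_bigr => k _.
by rewrite !inE mnmE; case: (k < c)%N; case: (k \in S).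
Qed.

Lemma longestV : (longest_perm n)^-1%g = longest_perm n.
Proof.
apply/permP=> k; apply: (@perm_inj _ (longest_perm n)).
by rewrite permKV; apply: val_inj; rewrite !permE rev_ordK.
Qed.

Lemma divdiff_mulsym i h g :
  msym (adj i) h = h -> divdiff i (h * g) = h * divdiff i g.
Proof.
move=> sh; symmetry; apply: divdiff_unique.
by rewrite -mulrA divdiffE msymM sh mulrBr.
Qed.

(** Before its first ascent [w] decreases, so [w (lo i)] is below all earlier values. This makes
    column [w (lo i)] of the Rothe diagram an initial segment. *)
Lemma first_ascent w : noninv w != 0%N -> exists i,
  (w (lo i) < w (hi i))%N /\ forall r, (r < i)%N -> (w (lo i) < w r)%N.
Proof.
move=> /exists_ascent[i0 hi0].
have [i wi imin] := arg_minnP (P := fun i => w (lo i) < w (hi i))%N (fun i => i : nat) hi0.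
exists i; split=> // r ri.
have chain d : forall r', (r' + d)%N = i -> (w (lo i) + d <= w r')%N.
  elim: d => [|d IH] r' e.
    by rewrite addn0 (_ : r' = lo i) //; apply: val_inj; rewrite /= -e addn0.
  have h' : (r' < n.-1)%N by have := ltn_ord i; lia.
  have [i' er] : exists i' : 'I_n.-1, r' = lo i'.
    by exists (Ordinal h'); apply: val_inj.
  have := IH (hi i'); rewrite er /= in e *; rewrite addSnnS => /(_ e).
  by have [/imin|] := ascent_or_descent i' w; lia.
by have := chain (i - r)%N r; rewrite subnKC ?(ltnW ri) // => /(_ erefl); lia.
Qed.

Lemma tight_tropical_schubert w f : schubert_rec w f ->
  tight_tropical f (cols_min [seq rothe w j | j <- enum 'I_n]).
Proof.
have [k] := ubnP (noninv w); elim: k w f => // k IH w f; rewrite ltnS => wk hf.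
have [/eqP n0|nn0] := boolP (noninv w == 0%N).
  have ew : w = longest_perm n.
    by apply: no_ascent => i; apply/negP => /noninv_ascent; rewrite n0.
  have -> : f = 'X_[staircase n].
    by apply: schubert_rec_unique hf _; rewrite ew; apply: schubert_longest.
  rewrite ew; apply: tight_tropical_initial_cols => [D a b /mapP[j _ ->] ab|r].
    by rewrite !inE longestV !permE /=; have := ltn_ord a; have := ltn_ord b; lia.
  rewrite big_map big_enum mnmE /=.
  rewrite (eq_bigr (fun j : 'I_n => (j < n - r.+1)%N : nat)) => [|j _]; last first.
    by rewrite inE longestV !permE /=; congr nat_of_bool;
      have := ltn_ord j; have := ltn_ord r; lia.
  by rewrite sum_ltn (minn_idPl (leq_subr _ _)).
have [i [wi imin]] := first_ascent nn0.
set w' := (adj i * w)%g; set j0 := w (lo i).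
have [f' hf'] := exists_schubert_rec w'.
have ef : f = divdiff i f' by apply: schubert_rec_unique hf (schubert_ascent wi hf').
have w'V j : (w'^-1%g) j = adj i (w^-1%g j) by rewrite invMg permM /adj tpermV.
have w'E r : w' r = w (adj i r) by rewrite permM.
have rothe_j0 : rothe w j0 = [set r : 'I_n | (r < i)%N].
  apply/setP=> r; rewrite !inE permK /=.
  by case: (ltnP r i) => ri; rewrite ?andbF // andbT; apply: imin.
have rothe_j0' : rothe w' j0 = [set r : 'I_n | (r < i.+1)%N].
  apply/setP=> r; rewrite !inE w'V permK adj_lo w'E /=.
  case: (ltnP r i.+1); rewrite ?andbF // andbT ltnS leq_eqVlt => /orP[/eqP e|ri].
    by rewrite (_ : r = lo i) ?adj_lo //; apply: val_inj.
  by rewrite adj_other ?imin // -val_eqE /= neq_ltn ?ri // (ltn_trans ri).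
(* The swap can alter the comparison [r < w^-1 j] only when [r] and [w^-1 j] are [lo i] and [hi i].
   One order is excluded by [j != j0], the other by [j < w r] and the ascent. *)
have swapE j : j != j0 -> rothe w j = swap_set i (rothe w' j).
  move=> jj0; apply/setP=> r; rewrite !inE w'E adjK w'V.
  case jr : (j < w r)%N => //=.
  have xl : w^-1%g j != lo i by apply: contra jj0 => /eqP e; rewrite /j0 -e permKV.
  apply/idP/idP => h; first apply: adj_lt => //.
    apply: contraTN jr => /andP[/eqP-> /eqP ex].
    by rewrite -[j](permKV w) ex -leqNgt ltnW.
  rewrite -[r](adjK i) -[w^-1%g j](adjK i); apply: adj_lt => //.
  by apply: contra xl => /andP[_ /eqP ex]; rewrite -(adjK i (w^-1%g j)) ex adj_hi.
have lo_hi D : D \in [seq rothe w' j | j <- enum 'I_n & j != j0] ->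
    (hi i \in D) ==> (lo i \in D).
  move=> /mapP[j _ ->]; rewrite !inE !w'E adj_hi adj_lo; apply/implyP=> /andP[h1 h2].
  by rewrite (ltn_trans h1 wi) (ltn_trans _ h2) /=.
have := IH w' f' _ hf'.
have -> : cols_min [seq rothe w' j | j <- enum 'I_n] = (fun S =>
    weight (initial_mnm i.+1) S +
    cols_min [seq rothe w' j | j <- enum 'I_n & j != j0] S)%N.
  apply: funext => S; rewrite /cols_min big_map big_enum /= (bigD1 j0) //=.
  by rewrite weight_initial rothe_j0' big_map big_filter big_enum_cond.
rewrite -ltnS -noninv_ascent // => /(_ wk) gf'.
(* The column [j0] of [w'] contributes 1 at each singleton of index at most [i], which forces these
   variables to divide every monomial of [f']. *)
have [] := tight_factor (o := initial_mnm i.+1) gf'.1.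
  by move=> r; rewrite /weight big_set1 leq_addr.
move=> Y eY; move: gf'; rewrite eY => /tight_tropical_mulX
  /(fun h => tight_tropical_reflect_cols h lo_hi) gY.
have -> : cols_min [seq rothe w j | j <- enum 'I_n] = (fun S =>
    weight (initial_mnm i) S + cols_min [seq swap_set i D |
      D <- [seq rothe w' j | j <- enum 'I_n & j != j0]] S)%N.
  apply: funext => S; rewrite /cols_min big_map big_enum /= (bigD1 j0) //=.
  rewrite weight_initial rothe_j0 2!big_map big_filter big_enum_cond; congr (_ + _)%N.
  by apply: eq_bigr => j /swapE ->.
(* The variables of index below [i] are fixed by [adj i] and leave the divided difference; the
   factor of index [i] stays inside and makes it isobaric. *)
suff -> : f = 'X_[initial_mnm i] * divdiff i ('X_(lo i) * Y) by apply/tight_tropical_mulX.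
rewrite ef eY -divdiff_mulsym.
  rewrite mulrA -mpolyXD; congr (divdiff i ('X_[_] * Y)); apply/mnmP=> r.
  rewrite !mnmE ltnS leq_eqVlt -(inj_eq val_inj) /= [_ == val r]eq_sym.
  by case: eqP => [->|_]; rewrite ?ltnn ?addn0.
rewrite msymX; congr 'X_[_]; apply/mnmP=> r; rewrite !mnmE /adj tpermV.
by case: tpermP => [->|->|//]; rewrite /= !ltnn ltnNge leqnSn.
Qed.

End SchubertColumns.

(** * Newton polytopes *)

Section Greedy.
Local Open Scope ring_scope.
Variables (R : realFieldType) (n : nat).
Implicit Types (c D u : 'I_n -> R) (s p q : seq 'I_n).

Definition sorted_by c s : bool := sorted >=%R [seq c k | k <- s].

(** Summation by parts. The free lower bound [t] carries the induction: when the last entry [a] is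
    removed, [c a] takes its place. *)
Lemma abel_sum c D s : sorted_by c s ->
  (forall p q, s = p ++ q -> 0 <= \sum_(k <- p) D k) ->
  forall t, (forall k, t <= c k) -> t * \sum_(k <- s) D k <= \sum_(k <- s) c k * D k.
Proof.
move=> cs hp t tc.
suff: forall t, (forall k, k \in s -> t <= c k) ->
    t * \sum_(k <- s) D k <= \sum_(k <- s) c k * D k by apply=> k _.
move=> {t tc}; elim/last_ind: s cs hp => [|s a IH] cs hp t ht.
  by rewrite !big_nil mulr0.
rewrite -!cats1 !big_cat !big_seq1 /=.
have le_a k : k \in s -> c a <= c k.
  move: cs; rewrite /sorted_by sorted_pairwise; last exact: (rev_trans le_trans).
  rewrite map_rcons -cats1 pairwise_cat => /and3P[+ _ _] ks.
  by move=> /allrelP /(_ (c k) (c a)); apply; rewrite ?map_f ?inE.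
have IHs : c a * \sum_(k <- s) D k <= \sum_(k <- s) c k * D k.
  apply: IH => // [|p q es]; last by apply: (hp p (rcons q a)); rewrite es rcons_cat.
  by move: cs; rewrite /sorted_by map_rcons -cats1 => /cat_sorted2[].
apply: (@le_trans _ _ (c a * (\sum_(k <- s) D k + D a))).
  apply: ler_wpM2r; last by apply: ht; rewrite mem_rcons inE eqxx.
  by have := hp (rcons s a) [::]; rewrite cats0 -cats1 big_cat big_seq1; apply.
by rewrite mulrDr lerD2r.
Qed.

Lemma small_perturbation (l : seq (R * R)) : exists2 e, 0 < e &
  forall e', 0 < e' -> e' <= e -> forall x, x \in l -> 0 < x.1 -> 0 < x.1 + e' * x.2.
Proof.
elim: l => [|[g v] l [e e0 he]]; first by exists 1.
have [g0|g0] := ltP 0 g; last first.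
  exists e => // e' e'0 le x; rewrite inE => /orP[/eqP-> /=|]; last exact: he.
  by rewrite ltNge g0.
have b0 : 0 < `|v| + 1 by rewrite ltr_wpDl.
(* The summand 1 avoids a zero denominator, and the factor 1/2 keeps the inequality strict. *)
exists (Num.min e (g / (`|v| + 1) / 2)); first by rewrite lt_min e0 !divr_gt0.
move=> e' e'0; rewrite le_min => /andP[le1 le2] x; rewrite inE.
case/orP=> [/eqP-> /= _|]; last exact: he.
have : e' * (`|v| + 1) <= g / 2.
  by rewrite -ler_pdivlMr // mulrAC.
have : - (e' * `|v|) <= e' * v by rewrite -mulrN ler_pM2l // lerNl ler_normr lexx orbT.
rewrite mulrDr mulr1; lra.
Qed.

(** A small enough perturbation only breaks ties of [c], never a strict inequality. *)
Lemma perturbed_sort c u : exists2 e, 0 < e &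
  forall s, sorted_by (fun k => c k + e * u k) s -> sorted_by c s.
Proof.
pose l := [seq (c ab.1 - c ab.2, u ab.1 - u ab.2) | ab <- enum {: 'I_n * 'I_n}].
have [e e0 he] := small_perturbation l; exists e => // s.
rewrite /sorted_by !sorted_map; apply: sub_sorted => a b /= le_ba.
rewrite leNgt; apply/negP => lt_ab; move: le_ba; apply/negP; rewrite -ltNge.
have in_l : (c b - c a, u b - u a) \in l.
  by apply/mapP; exists (b, a); rewrite ?mem_enum.
by have := he e e0 (lexx _) _ in_l; rewrite /= subr_gt0 => /(_ lt_ab); lra.
Qed.

Lemma exists_sorted_by c : exists2 s, perm_eq s (enum 'I_n) & sorted_by c s.
Proof.
exists (sort (fun a b => c b <= c a) (enum 'I_n)); first by rewrite perm_sort.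
by rewrite /sorted_by sorted_map; apply: sort_sorted => a b; apply: le_total.
Qed.

End Greedy.

(** * Vertices and the supermodular function *)

Section Newton.
Local Open Scope ring_scope.
Variables (R : realType) (n : nat).
Implicit Types (f : {mpoly int[n]}) (m : 'X_{1..n}) (x y z v : 'rV[R]_n).
Implicit Types (c u : 'I_n -> R) (S : {set 'I_n}) (s p q : seq 'I_n).
Implicit Types (mu : {set 'I_n} -> nat).

Definition point m : 'rV[R]_n := \row_j (m j)%:R.

Definition dot c x : R := \sum_j c j * x 0 j.

Lemma dot_comb k c (a : 'I_k -> R) (v : 'I_k -> 'rV[R]_n) :
  dot c (\sum_j a j *: v j) = \sum_j a j * dot c (v j).
Proof.
rewrite /dot; under [RHS]eq_bigr do rewrite mulr_sumr.
rewrite exchange_big; apply: eq_bigr => j _.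
rewrite summxE mulr_sumr; apply: eq_bigr => l _.
by rewrite mxE mulrCA.
Qed.

Lemma newton_ge f c d x : (forall m, m \in msupp f -> d <= dot c (point m)) ->
  newton R f x -> d <= dot c x.
Proof.
move=> ge [k [v [a [va a0 a1 ->]]]]; rewrite dot_comb -[d]mul1r -a1 mulr_suml.
apply: ler_sum => j _; apply: ler_wpM2l => //.
by have [m mf <-] := va j; apply: ge.
Qed.

Lemma newton_point f m : m \in msupp f -> newton R f (point m).
Proof.
move=> mf; exists 1%N, (fun=> point m), (fun=> 1); split=> //.
- by move=> _; exists m.
- by rewrite big_ord1.
- by rewrite big_ord1 scale1r.
Qed.

(** In a convex combination attaining the minimum, every exponent with nonzero coefficient attains
    it too, hence lies in the face [[set v]]. *)
Lemma newton_vertex f v : is_vertex (newton R f) v -> exists2 m, m \in msupp f & v = point m.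
Proof.
move=> [c [d [ge fe]]].
have : [set v]%classic v by [].
rewrite fe => -[[k [w [a [wa a0 a1 ev]]]] ed].
have wge j : d <= dot c (w j) by have [m mf <-] := wa j; apply/ge/newton_point.
have sum0 : \sum_j a j * (dot c (w j) - d) = 0.
  under eq_bigr do rewrite mulrBr.
  by rewrite sumrB -dot_comb -ev -mulr_suml a1 mul1r [dot c v]ed subrr.
have [j aj] : exists j, a j != 0.
  have [j aj|all0] := pickP (fun j => a j != 0); first by exists j.
  have /eqP := a1; rewrite big1 ?(eq_sym 0) ?oner_eq0 // => j _.
  by have /negbFE/eqP := all0 j.
have [m mf em] := wa j; exists m => //; rewrite /point em.
have : [set v]%classic (w j).
  rewrite fe; split; first by rewrite -em; apply: newton_point.
  have term0 l : true -> 0 <= a l * (dot c (w l) - d) by rewrite mulr_ge0 ?subr_ge0.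
  have /eqP := psumr_eq0P term0 sum0 (i := j) isT.
  by rewrite mulf_eq0 (negbTE aj) subr_eq0 => /eqP.
by move=> ->.
Qed.

Definition indicator S : 'I_n -> R := fun k => (k \in S)%:R.

Lemma dot_indicator S x : dot (indicator S) x = \sum_(k in S) x 0 k.
Proof.
rewrite /dot [RHS]big_mkcond; apply: eq_bigr => k _; rewrite /indicator.
by case: ifP; rewrite ?mul1r ?mul0r.
Qed.

Lemma dot_indicator_point S m : dot (indicator S) (point m) = (weight m S)%:R.
Proof. by rewrite dot_indicator /weight natr_sum; apply: eq_bigr => k _; rewrite mxE. Qed.

Lemma newton_mu f mu S x : tight f mu -> newton R f x -> (mu S)%:R <= \sum_(k in S) x 0 k.
Proof.
move=> [ge _] /newton_ge; rewrite -dot_indicator; apply=> m mf.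
by rewrite dot_indicator_point ler_nat ge.
Qed.

(** The bound is attained at the exponent tight on a chain that lists [S] before its complement. *)
Lemma supermod_newton f mu S : tight f mu -> supermod (newton R f) S = (mu S)%:R.
Proof.
move=> tf; have [_ [_ tt]] := tf.
have [|m mf hm] := tt (enum S ++ enum (~: S)).
  apply: uniq_perm => [||k]; rewrite ?enum_uniq //.
    rewrite cat_uniq !enum_uniq andbT; apply/hasPn => k; rewrite !mem_enum.
    by rewrite inE.
  by rewrite mem_cat !mem_enum inE orbN.
have {}hm : weight m S = mu S.
  have := hm _ _ erefl; rewrite (_ : [set x in enum S] = S) //.
  by apply/setP=> k; rewrite inE mem_enum.
have pS : \sum_(k in S) point m 0 k = (mu S)%:R.
  by rewrite -dot_indicator dot_indicator_point hm.
apply: xget_unique => [|r [[x xP <-] lb]].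
  split; last by move=> _ [x xP <-]; apply: newton_mu tf xP.
  by exists (point m); [apply: newton_point | exact: pS].
apply/eqP; rewrite eq_le (newton_mu _ tf) // andbT; apply: lb.
by exists (point m); [apply: newton_point | exact: pS].
Qed.

End Newton.

(** * Edge directions *)

Section Edges.
Local Open Scope ring_scope.
Variables (R : realType) (n : nat).
Implicit Types (f : {mpoly int[n]}) (m : 'X_{1..n}) (x y z v : 'rV[R]_n).
Implicit Types (c u : 'I_n -> R) (S : {set 'I_n}) (s p q l r : seq 'I_n).
Implicit Types (mu : {set 'I_n} -> nat) (a b k : 'I_n).

Definition tight_at mu s m : Prop :=
  forall p q, s = p ++ q -> weight m [set x in p] = mu [set x in p].

(** The coordinates of a tight exponent are the successive increments of [mu] along the chain, which
    therefore determines it. *)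
Lemma tight_at_coord mu s p k q m : uniq s -> s = p ++ k :: q -> tight_at mu s m ->
  (mu [set x in p] + m k = mu [set x in rcons p k])%N.
Proof.
move=> us es tm; rewrite -(tm _ _ es) -(tm (rcons p k) q); last by rewrite cat_rcons.
have kp : k \notin p.
  by move: us; rewrite es cat_uniq /= negb_or => /and3P[_ /andP[]].
rewrite /weight (_ : [set x in rcons p k] = k |: [set x in p]); last first.
  by apply/setP=> j; rewrite !inE mem_rcons inE.
by rewrite big_setU1 ?inE //= addnC.
Qed.

(** An adjacent swap changes a single set of the chain, so only the increments at [a] and [b]
    change, and their sum does not. *)
Lemma tight_swap f mu l a b r m : tight f mu ->
  perm_eq (l ++ a :: b :: r) (enum 'I_n) -> tight_at mu (l ++ a :: b :: r) m ->
  exists m', [/\ m' \in msupp f, tight_at mu (l ++ b :: a :: r) m',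
    forall k, k != a -> k != b -> m' k = m k & (m' a + m' b = m a + m b)%N].
Proof.
move=> [_ [_ tt]] ps tm.
have ps' : perm_eq (l ++ b :: a :: r) (enum 'I_n).
  apply: perm_trans ps; rewrite perm_cat2l -[b :: a :: r]/([:: b; a] ++ r).
  by rewrite -[a :: b :: r]/([:: a; b] ++ r) perm_cat2r (perm_catC [:: b] [:: a]).
have us : uniq (l ++ a :: b :: r) by rewrite (perm_uniq ps) enum_uniq.
have us' : uniq (l ++ b :: a :: r) by rewrite (perm_uniq ps') enum_uniq.
have [m' m'f tm'] := tt _ ps'; exists m'; split=> //.
  move=> k ka kb; have : k \in l ++ a :: b :: r by rewrite (perm_mem ps) mem_enum.
  rewrite mem_cat !inE (negbTE ka) (negbTE kb) /= => /orP[] /splitPr kin.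
    case: kin us us' tm tm' => l1 l2 us us' tm tm'; rewrite -!catA /= in us us' tm tm'.
    have := tight_at_coord us erefl tm; have := tight_at_coord us' erefl tm'.
    by move=> <- /addnI.
  case: kin us us' tm tm' => r1 r2 us us' tm tm'.
  have e1 : l ++ a :: b :: r1 ++ k :: r2 = (l ++ a :: b :: r1) ++ k :: r2 by rewrite -catA.
  have e2 : l ++ b :: a :: r1 ++ k :: r2 = (l ++ b :: a :: r1) ++ k :: r2 by rewrite -catA.
  have := tight_at_coord us e1 tm; have := tight_at_coord us' e2 tm'.
  have sw q : [set x in l ++ b :: a :: q] = [set x in l ++ a :: b :: q].
    by apply/setP=> j; rewrite !inE !mem_cat !inE; congr (_ || _); rewrite orbCA.
  by rewrite !rcons_cat /= !sw => <- /addnI.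
have e1 : l ++ a :: b :: r = rcons l a ++ b :: r by rewrite cat_rcons.
have e2 : l ++ b :: a :: r = rcons l b ++ a :: r by rewrite cat_rcons.
have := tight_at_coord us erefl tm; have := tight_at_coord us e1 tm.
have := tight_at_coord us' erefl tm'; have := tight_at_coord us' e2 tm'.
have -> : [set x in rcons (rcons l a) b] = [set x in rcons (rcons l b) a].
  by apply/setP=> j; rewrite !inE !mem_rcons !inE !mem_rcons !inE orbCA.
move=> h1 h2 h3 h4; apply/eqP; rewrite -(eqn_add2l (mu [set x in l])); apply/eqP.
by rewrite addnA [in LHS]addnAC h2 h1 addnA h4 h3.
Qed.

Lemma newton_total f mu x : tight f mu -> newton R f x ->
  \sum_(k in [set: 'I_n]) x 0 k = (mu setT)%:R.
Proof.
move=> tf xP; apply/eqP; rewrite eq_le (newton_mu _ tf) // andbT -lerN2.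
have -> : - (\sum_(k in setT) x 0 k) = dot (fun=> -1) x.
  by rewrite /dot -sumrN; apply: eq_big => k; rewrite ?inE // mulN1r.
apply: newton_ge xP => m mf; rewrite -(tf.2.1 m mf) -dot_indicator_point dot_indicator.
rewrite /dot -sumrN le_eqVlt; apply/orP; left; apply/eqP.
by apply: eq_big => k; rewrite ?inE // mulN1r.
Qed.

(** Correctness of the greedy algorithm: [x] minus the tight exponent has nonnegative sums over
    prefixes of [s] and total sum 0, so [abel_sum] applies with any lower bound of [c]. *)
Lemma tight_min f mu c s m x : tight f mu -> perm_eq s (enum 'I_n) ->
  sorted_by c s -> tight_at mu s m -> newton R f x -> dot c (point R m) <= dot c x.
Proof.
move=> tf ps cs tm xP; pose D k := x 0 k - point R m 0 k.
have us : uniq s by rewrite (perm_uniq ps) enum_uniq.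
have sumD p q : s = p ++ q -> \sum_(k <- p) D k =
    \sum_(k in [set x in p]) x 0 k - (mu [set x in p])%:R.
  move=> es; have up : uniq p by move: us; rewrite es cat_uniq => /andP[].
  rewrite -(tm _ _ es) -(@dot_indicator_point R) dot_indicator -sumrB big_uniq //.
  by apply: eq_bigl => k; rewrite inE.
have := @abel_sum R n c D s cs _ (- \sum_k `|c k|) _.
rewrite (sumD s [::]) ?cats0 // (_ : [set x in s] = setT); last first.
  by apply/setP=> k; rewrite !inE (perm_mem ps) mem_enum.
rewrite (newton_total tf xP) subrr mulr0 (perm_big _ ps) big_enum /=.
have -> : \sum_(k in 'I_n) c k * D k = dot c x - dot c (point R m).
  by rewrite /dot -sumrB; apply: eq_bigr => k _; rewrite mulrBr.
rewrite subr_ge0.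
apply=> [p q es|k]; first by rewrite (sumD _ _ es) subr_ge0 (newton_mu _ tf).
rewrite lerNl (bigD1 k) //= -normrN ler_wpDr ?ler_norm // ?sumr_ge0 //.
Qed.

(** If no such direction exists, all chains sorted by [c] share one tight exponent. It then
    minimizes over [F] both the functional u = y - x and its opposite, which forces x = y. *)
Lemma edge_direction f mu F : tight f mu -> is_edge (newton R f) F ->
  exists i j : 'I_n, i != j /\ parallel_to F ('e_i - 'e_j).
Proof.
move=> tf [[c [d [ge fe]]] [x [y [Fx Fy xy line]]]].
apply: contrapT => nodir.
have Fp z : F z -> newton R f z /\ dot c z = d by rewrite fe.
have [xP xd] := Fp x Fx; have [yP yd] := Fp y Fy.
have inF s m : perm_eq s (enum 'I_n) -> sorted_by c s -> m \in msupp f ->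
    tight_at mu s m -> F (point R m).
  move=> ps cs mf tm; rewrite fe; split; first exact: newton_point.
  apply/eqP; rewrite eq_le (ge _ (newton_point _ mf)) andbT -[X in _ <= X]xd.
  exact: tight_min tm xP.
have perm_swap l a b r : perm_eq (l ++ a :: b :: r) (l ++ b :: a :: r).
  rewrite perm_cat2l -[b :: a :: r]/([:: b; a] ++ r).
  by rewrite -[a :: b :: r]/([:: a; b] ++ r) perm_cat2r (perm_catC [:: a] [:: b]).
have sorted_swap l a b r : c a = c b ->
    sorted_by c (l ++ a :: b :: r) -> sorted_by c (l ++ b :: a :: r).
  by move=> cab; rewrite /sorted_by !map_cat /= cab.
have step l a b r m : perm_eq (l ++ a :: b :: r) (enum 'I_n) -> c a = c b ->
    sorted_by c (l ++ a :: b :: r) -> m \in msupp f ->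
    tight_at mu (l ++ a :: b :: r) m -> tight_at mu (l ++ b :: a :: r) m.
  move=> ps cab cs mf tm.
  have [m' [m'f tm' other sum_ab]] := tight_swap tf ps tm.
  have us : uniq (l ++ a :: b :: r) by rewrite (perm_uniq ps) enum_uniq.
  have ab : a != b.
    by move: us; rewrite cat_uniq /= inE => /and3P[_ _ /andP[]]; case: eqP.
  have [ea|na] := eqVneq (m' a) (m a).
    suff -> : m = m' by [].
    apply/mnmP=> k; have [->//|ka] := eqVneq k a.
    have [->|kb] := eqVneq k b; last by rewrite other.
    by move: sum_ab; rewrite ea => /addnI.
  (* If the swap changes the exponent, then [m] and [m'] are two points of [F] differing by a
     multiple of e_a - e_b, and [F] lies on a line. *)
  case: nodir; exists a, b; split=> //.
  have Fm := inF _ _ ps cs mf tm.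
  have Fm' : F (point R m').
    apply: (inF (l ++ b :: a :: r)) => //; last exact: sorted_swap cs.
    by apply: perm_trans ps; apply: perm_swap.
  have [t1 e1] := line _ Fm; have [t2 e2] := line _ Fm'.
  pose t0 : R := (m' a)%:R - (m a)%:R.
  have t00 : t0 != 0 by rewrite subr_eq0 eqr_nat.
  have dir : (t2 - t1) *: (y - x) = t0 *: ('e_a - 'e_b).
    rewrite scalerBl; apply: (@etrans _ _ (point R m' - point R m)).
      by rewrite e1 e2 opprD addrACA subrr add0r.
    apply/rowP=> k; rewrite !mxE /= /t0.
    have [->|ka] := eqVneq k a; first by rewrite (negbTE ab) subr0 mulr1.
    have [->|kb] := eqVneq k b; last by rewrite other // !subrr mulr0.
    have : (m' a + m' b)%:R = (m a + m b)%:R :> R by rewrite sum_ab.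
    by rewrite !natrD sub0r mulrN1; lra.
  have t12 : t2 - t1 != 0.
    apply: contraNneq t00 => t12; move: dir; rewrite t12 scale0r => /rowP/(_ a).
    by rewrite !mxE !eqxx (negbTE ab) subr0 mulr1 => <-.
  move=> z1 z2 /line[s1 ->] /line[s2 ->]; exists ((s2 - s1) / (t2 - t1) * t0).
  rewrite opprD addrACA subrr add0r -scalerBl -scalerA -dir scalerA.
  by rewrite mulfVK.
have move_front p1 : forall l a p2 m, perm_eq (l ++ p1 ++ a :: p2) (enum 'I_n) ->
    (forall b, b \in p1 -> c b = c a) -> sorted_by c (l ++ p1 ++ a :: p2) ->
    m \in msupp f -> tight_at mu (l ++ p1 ++ a :: p2) m ->
    sorted_by c (l ++ a :: p1 ++ p2) /\ tight_at mu (l ++ a :: p1 ++ p2) m.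
  elim/last_ind: p1 => [//|p1 b IH] l a p2 m ps cb cs mf tm.
  rewrite !cat_rcons in ps cs tm *; rewrite catA in ps cs tm.
  have cba : c b = c a by apply: cb; rewrite mem_rcons inE eqxx.
  apply: IH; rewrite ?catA //.
  - by apply: perm_trans ps; apply: perm_swap.
  - by move=> b' b'p; apply: cb; rewrite mem_rcons inE b'p orbT.
  - exact: sorted_swap cs.
  - exact: step tm.
(* Insertion sort turns one sorted chain into another. Both being sorted by [c], the entries that
   [a] passes on its way to the front are tied with it. *)
have walk s2 : forall s1 l m, perm_eq s1 s2 -> perm_eq (l ++ s1) (enum 'I_n) ->
    sorted_by c (l ++ s1) -> sorted_by c (l ++ s2) -> m \in msupp f ->
    tight_at mu (l ++ s1) m -> tight_at mu (l ++ s2) m.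
  elim: s2 => [|a s2 IH] s1 l m p12 ps cs1 cs2 mf tm.
    by move: tm; rewrite (perm_nilP p12).
  have as1 : a \in s1 by rewrite (perm_mem p12) inE eqxx.
  case/splitPr: as1 p12 ps cs1 tm => p1 p2 p12 ps cs1 tm.
  have p12' : perm_eq (p1 ++ p2) s2.
    by rewrite -(perm_cons a) -(perm_catCA p1 [:: a] p2).
  have cb b : b \in p1 -> c b = c a.
    move=> bp; apply/eqP; rewrite eq_le; apply/andP; split.
      move: cs2; rewrite /sorted_by sorted_pairwise; last exact: (rev_trans le_trans).
      rewrite map_cat /= pairwise_cat /= => /and3P[_ _ /andP[/allP h _]].
      by apply/h/map_f; rewrite -(perm_mem p12') mem_cat bp.
    move: cs1; rewrite /sorted_by sorted_pairwise; last exact: (rev_trans le_trans).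
    rewrite catA !map_cat /= pairwise_cat => /and3P[/allrelP h _ _].
    by apply: h; rewrite ?inE ?eqxx // -map_cat map_f // mem_cat bp orbT.
  have [cs' tm'] := move_front p1 l a p2 m ps cb cs1 mf tm.
  rewrite -cat_rcons in cs2 *; rewrite -cat_rcons in cs' tm'.
  apply: IH cs' cs2 mf tm' => //.
  apply: perm_trans ps; rewrite cat_rcons perm_cat2l perm_sym.
  by rewrite -[a :: p1 ++ p2]/([:: a] ++ p1 ++ p2) (perm_catCA p1 [:: a] p2).
(* Perturbing [c] along [u] and along [-u] gives two chains, both still sorted by [c], hence with
   the same tight exponent. *)
pose u k := (y - x) 0 k.
have [e e0 he] := perturbed_sort c u.
have [e' e'0 he'] := perturbed_sort c (fun k => - u k).
have [s ps cs] := exists_sorted_by (fun k => c k + e * u k).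
have [s' ps' cs'] := exists_sorted_by (fun k => c k + e' * - u k).
have [m mf tm] := tf.2.2 s ps.
have tm' : tight_at mu s' m.
  apply: (walk s' s [::]) (he _ cs) (he' _ cs') mf tm => //.
  by apply: perm_trans ps _; rewrite perm_sym.
have [_ md] := Fp _ (inF s m ps (he _ cs) mf tm).
have dotD g (h : 'I_n -> R) z : dot (fun k => c k + g * h k) z = dot c z + g * dot h z.
  by rewrite /dot mulr_sumr -big_split /=; apply: eq_bigr => k _; rewrite mulrDl mulrA.
have dotN z : dot (fun k => - u k) z = - dot u z.
  by rewrite /dot -sumrN; apply: eq_bigr => k _; rewrite mulNr.
have eqF z : F z -> dot u z = dot u (point R m).
  move=> /Fp[zP zd]; apply/eqP; rewrite eq_le.
  have := tight_min tf ps' cs' tm' zP.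
  rewrite !dotD !dotN md zd lerD2l ler_pM2l // lerN2 => ->.
  by have := tight_min tf ps cs tm zP; rewrite !dotD md zd lerD2l ler_pM2l.
have uu : \sum_k u k * u k = 0.
  have d0 : dot u y - dot u x = 0 by rewrite !eqF ?subrr.
  rewrite -[RHS]d0 /dot -sumrB; apply: eq_bigr => k _; rewrite -mulrBr; congr (_ * _).
  by rewrite /u !mxE.
case/eqP: xy; apply/rowP=> k; apply/eqP; rewrite eq_sym -subr_eq0.
have := psumr_eq0P (fun k _ => sqr_ge0 (u k)) uu (i := k) isT.
by move/eqP; rewrite mulf_eq0 orbb /u !mxE.
Qed.

Lemma tight_tropical_MV_polytope f mu : tight_tropical f mu -> MV_polytope (newton R f).
Proof.
move=> [tf mv]; split; [split; [split|]|].
- have [_ [_ /(_ _ (perm_refl _))[m mf _]]] := tf.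
  exists [seq point R m | m <- msupp f]; first by case: (msupp f) mf.
  congr conv; apply/predeqP => x /=; split=> [[m' m'f <-]|/mapP[m' m'f ->]].
    exact: map_f.
  by exists m'.
- by move=> F; apply: edge_direction tf.
- move=> v /newton_vertex[m _ ->] j; exists (m j).
  by rewrite mxE.
- move=> S a b c aS bS cS ab bc; rewrite !(supermod_newton _ _ tf) -!natrD mv //.
  by rewrite natr_min.
Qed.

End Edges.

Theorem corollary1p2 (R : realType) (n : nat) :
  (forall (w : {perm 'I_n}) (X : {mpoly int[n]}),
     is_schubert w X -> MV_polytope (newton R X)) /\
  (forall (alpha : 'X_{1..n}) (kappa : {mpoly int[n]}),
     is_key alpha kappa -> MV_polytope (newton R kappa)).
Proof.
split=> [w X /is_schubert_rec/tight_tropical_schubert|alpha kappa key].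
  exact: tight_tropical_MV_polytope.
(* The total degree serves as a common bound on the parts, that is, as the number of columns. *)
have leN k : (alpha k <= mdeg alpha)%N by rewrite mdegE (bigD1 k) //= leq_addr.
exact: tight_tropical_MV_polytope (tight_tropical_key key leN).
Qed.
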